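(* Let $A\simeq kQ_A/I_A$ be an algebra and let $a\in(Q_A)_0$ be a sink. Let $T[a]$ be the APR-tilting $A$-module corresponding to the vertex $a$ and let $B=\mathrm{End}_A(T[a])$. If $B$ is representation-finite, then $r_A\leq r_B$.
   Context: $k$ is an algebraically closed field; an algebra is a finite dimensional basic $k$-algebra; $\mathrm{mod}\,A$ is the category of finitely generated left $A$-modules. $Q_A$ is the ordinary quiver of $A$, $I_A$ an admissible ideal, and $P_a,S_a$ are the indecomposable projective and the simple $A$-module at the vertex $a$; conventions are such that $P_a$ is simple exactly when $a$ is a sink. APR-tilting module: for a sink $a$ such that $P_a=S_a$ is simple projective and non-injective, $T[a]=\tau^{-1}(S_a)\oplus\bigoplus_{b\neq a}P_b$, where $\tau^{-1}=\mathrm{TrD}$ is the inverse Auslander–Reiten translation. It is a separating tilting module, so if $B$ is representation-finite then so is $A$. Radical: $\Re(X,Y)$ is the set of morphisms $f:X\to Y$ such that $h'fh$ is not an isomorphism for all indecomposable $M$ and all $h:M\to X$, $h':Y\to M$; powers $\Re^n$ are defined inductively. $r_A$ (resp. $r_B$) is the nilpotency index of $\Re(\mathrm{mod}\,A)$ (resp. $\Re(\mathrm{mod}\,B)$), i.e. the minimal $m\ge1$ such that $\Re^m$ vanishes. *)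

(* Defs.v *)
From HB Require Import structures.
From mathcomp Require Import all_boot all_order all_algebra all_field.
From mathcomp Require Import finmap monalg.

Set Implicit Arguments.
Unset Strict Implicit.
Unset Printing Implicit Defensive.

Import GRing.Theory.
Local Open Scope ring_scope.

(* mathcomp equips the converse ring A^c only with its ring structure; with the
   k-algebra structure below, right A-modules are left modules over opp_alg A. *)
Section ConverseAlgebra.
Variables (k : fieldType) (A : falgType k).

HB.instance Definition _ := Vector.copy A^c A.
HB.instance Definition _ :=
  GRing.Lmodule_isLalgebra.Build k A^c (fun c x y => @scalerAr k A c y x).
HB.instance Definition _ :=
  GRing.Lalgebra_isAlgebra.Build k A^c (fun c x y => @scalerAl k A c y x).

Definition opp_alg : falgType k := A^c.

Lemma opp_algM (x y : opp_alg) : x * y = (y : A) * (x : A).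
Proof. by []. Qed.

End ConverseAlgebra.

Section Modules.
Variables (k : fieldType) (A : falgType k).

(* As A is finite dimensional over k, a finitely generated left A-module is a
   finite dimensional k-space with a k-bilinear, unital and associative
   action of A. *)
Record lmodule := LModule {
  carrier :> vectType k;
  act : A -> carrier -> carrier;
  act_linearl : forall m, linear (act^~ m);
  act_linearr : forall x, linear (act x);
  act1 : forall m, act 1 m = m;
  actM : forall x y m, act (x * y) m = act x (act y m) }.

HB.instance Definition _ (M : lmodule) (x : A) :=
  GRing.isSemilinear.Build k M M _ (@act M x)
    (GRing.semilinear_linear (act_linearr x)).

(* Homomorphisms are automatically k-linear, hence elements of 'Hom(M, N). *)
Definition is_hom (M N : lmodule) (f : 'Hom(M, N)) : Prop :=
  forall x m, f (act x m) = act x (f m).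

Definition is_iso (M N : lmodule) (f : 'Hom(M, N)) : Prop :=
  is_hom f /\ bijective f.

Definition isomorphic (M N : lmodule) : Prop := exists f : 'Hom(M, N), is_iso f.

Definition submodule (M : lmodule) (U : {vspace M}) : Prop :=
  forall x m, m \in U -> act x m \in U.

Definition simple_mod (M : lmodule) : Prop :=
  (fullv : {vspace M}) != 0%VS /\
  forall U : {vspace M}, submodule U -> U = 0%VS \/ U = fullv.

Definition indecomposable (M : lmodule) : Prop :=
  (fullv : {vspace M}) != 0%VS /\
  forall U W : {vspace M}, submodule U -> submodule W ->
    (U + W)%VS = fullv -> (U :&: W)%VS = 0%VS -> U = 0%VS \/ W = 0%VS.

Definition projective_mod (P : lmodule) : Prop :=
  forall (M N : lmodule) (g : 'Hom(M, N)) (f : 'Hom(P, N)),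
    is_hom g -> is_hom f -> limg g = fullv ->
    exists h : 'Hom(P, M), is_hom h /\ (g \o h)%VF = f.

Definition injective_mod (I : lmodule) : Prop :=
  forall (M N : lmodule) (g : 'Hom(M, N)) (f : 'Hom(M, I)),
    is_hom g -> is_hom f -> lker g = 0%VS ->
    exists h : 'Hom(N, I), is_hom h /\ (h \o g)%VF = f.

Definition is_direct_sum (J : finType) (M : J -> lmodule) (T : lmodule) : Prop :=
  exists (inj : forall i, 'Hom(M i, T)) (prj : forall i, 'Hom(T, M i)),
  [/\ forall i, is_hom (inj i) /\ is_hom (prj i),
      forall i, (prj i \o inj i)%VF = \1%VF,
      forall i j, i != j -> (prj j \o inj i)%VF = 0
    & \sum_i (inj i \o prj i)%VF = \1%VF].

Definition superfluous (M : lmodule) (K : {vspace M}) : Prop :=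
  forall U : {vspace M}, submodule U -> (U + K)%VS = fullv -> U = fullv.

(* P1 -f-> P0 -g-> X -> 0 is exact and P0 -> X, P1 -> Ker g are projective
   covers. *)
Definition minimal_projective_presentation (P1 P0 X : lmodule)
    (f : 'Hom(P1, P0)) (g : 'Hom(P0, X)) : Prop :=
  [/\ projective_mod P1 /\ projective_mod P0, is_hom f /\ is_hom g,
      limg g = fullv /\ limg f = lker g
    & superfluous (lker g) /\ superfluous (lker f)].

Definition representation_finite : Prop :=
  exists (n : nat) (L : 'I_n -> lmodule),
    forall M, indecomposable M -> exists i, isomorphic M (L i).

Definition Rad (X Y : lmodule) (f : 'Hom(X, Y)) : Prop :=
  is_hom f /\
  forall (M : lmodule) (h : 'Hom(M, X)) (h' : 'Hom(Y, M)),
    indecomposable M -> is_hom h -> is_hom h' -> ~ is_iso (h' \o (f \o h))%VF.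

(* Rad^(n+1)(X, Y) consists of the finite sums of composites
   X -> Z_i -> Y of a map in Rad^n(X, Z_i) and a map in Rad(Z_i, Y). *)
Fixpoint Rad_pow (n : nat) (X Y : lmodule) (f : 'Hom(X, Y)) : Prop :=
  match n with
  | 0 => is_hom f
  | 1 => Rad f
  | n'.+1 =>
    exists (r : nat) (Z : 'I_r -> lmodule)
           (g : forall i, 'Hom(X, Z i)) (h : forall i, 'Hom(Z i, Y)),
      (forall i, Rad_pow n' (g i) /\ Rad (h i)) /\
      f = \sum_i (h i \o g i)%VF
  end.

Definition Rad_pow_zero (m : nat) : Prop :=
  forall (X Y : lmodule) (f : 'Hom(X, Y)), Rad_pow m f -> f = 0.

Definition is_nilpotency_index (r : nat) : Prop :=
  [/\ (1 <= r)%N, Rad_pow_zero r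
    & forall m, (1 <= m)%N -> Rad_pow_zero m -> (r <= m)%N].

Definition regular_mod : lmodule.
Proof.
refine (@LModule A (fun x y => x * y) _ _ _ _).
- by move=> m c x y /=; rewrite mulrDl scalerAl.
- by move=> x c m n /=; rewrite mulrDr scalerAr.
- exact: mul1r.
- by move=> x y m; rewrite mulrA.
Defined.

Definition left_ideal_gen (e : A) : {vspace A} := limg (amulr e).

Lemma left_ideal_genP (e z : A) :
  reflect (exists y, z = y * e) (z \in left_ideal_gen e).
Proof.
apply: (iffP memv_imgP) => [[y _ ->]|[y ->]]; exists y; rewrite ?memvf //;
  by rewrite lfunE.
Qed.

Lemma left_ideal_gen_mul (e x : A) (u : subvs_of (left_ideal_gen e)) :
  x * vsval u \in left_ideal_gen e.
Proof.
have /left_ideal_genP[y ->] := subvsP u.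
by apply/left_ideal_genP; exists (x * y); rewrite mulrA.
Qed.

(* the left ideal A e *)
Definition principal_mod (e : A) : lmodule.
Proof.
refine (@LModule (subvs_of (left_ideal_gen e))
  (fun x u => vsproj (left_ideal_gen e) (x * vsval u)) _ _ _ _).
- by move=> m c x y /=; rewrite mulrDl -scalerAl linearP.
- by move=> x c m n /=; rewrite mulrDr -scalerAr linearP.
- by move=> m; rewrite mul1r vsvalK.
- by move=> x y m; rewrite (vsprojK (left_ideal_gen_mul y m)) mulrA.
Defined.

Definition act_lfun (M : lmodule) (x : A) : 'End(M) := linfun (act x).

Lemma act_sumZl (M : lmodule) (m : M) n (c : 'I_n -> k) (x : 'I_n -> A) :
  act (\sum_i c i *: x i) m = \sum_i c i *: act (x i) m.
Proof.
have act0 : act (0 : A) m = 0.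
  have := act_linearl m (-1) 0 (0 : A).
  by rewrite scaleN1r oppr0 addr0 scaleN1r addNr.
elim/big_rec2: _ => [|i y z _ <-]; first exact: act0.
exact: act_linearl.
Qed.

Definition hom_defect (M N : lmodule) (x : A) (f : 'Hom(M, N)) : 'Hom(M, N) :=
  (f \o act_lfun M x)%VF - (act_lfun N x \o f)%VF.

Fact hom_defect_linear (M N : lmodule) (x : A) : linear (@hom_defect M N x).
Proof.
move=> c f g; rewrite /hom_defect.
rewrite comp_lfunDl comp_lfunDr -comp_lfunZl -comp_lfunZr.
by rewrite scalerBr opprD addrACA.
Qed.

HB.instance Definition _ (M N : lmodule) (x : A) :=
  GRing.isSemilinear.Build k 'Hom(M, N) 'Hom(M, N) _ (@hom_defect M N x)
    (GRing.semilinear_linear (@hom_defect_linear M N x)).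

Lemma hom_defect_eq0 (M N : lmodule) (x : A) (f : 'Hom(M, N)) :
  (hom_defect x f = 0) <-> (forall m, f (act x m) = act x (f m)).
Proof.
split=> [/lfunP fx m | fx]; last first.
  apply/lfunP=> m; rewrite add_lfunE opp_lfunE !comp_lfunE !lfunE /=.
  by rewrite fx subrr.
move: (fx m); rewrite add_lfunE opp_lfunE !comp_lfunE !lfunE /=.
by move/eqP; rewrite subr_eq0 => /eqP.
Qed.

(* Hom_A(M, N), as a subspace of Hom_k(M, N) *)
Definition hom_space (M N : lmodule) : {vspace 'Hom(M, N)} :=
  (\bigcap_(i < \dim {:A}) lker (linfun (@hom_defect M N (vbasis {:A})`_i)))%VS.

Lemma hom_spaceP (M N : lmodule) (f : 'Hom(M, N)) :
  reflect (is_hom f) (f \in hom_space M N).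
Proof.
apply: (iffP idP) => [|fA]; rewrite memvE; last first.
  apply/subv_bigcapP=> i _; rewrite -memvE memv_ker lfunE /=.
  by apply/eqP/hom_defect_eq0.
move=> /subv_bigcapP fH x m.
have fb (i : 'I_(\dim {:A})) : f (act (vbasis {:A})`_i m)
    = act (vbasis {:A})`_i (f m).
  apply: (iffLR (hom_defect_eq0 _ _)).
  by have := fH i isT; rewrite -memvE memv_ker lfunE /= => /eqP.
rewrite (coord_vbasis (memvf x)) !act_sumZl linear_sum.
by apply: eq_bigr => i _; rewrite linearZ /= fb.
Qed.

Lemma hom_in_space (M N : lmodule) (u : subvs_of (hom_space M N)) :
  is_hom (vsval u).
Proof. exact/hom_spaceP/subvsP. Qed.

End Modules.

Arguments Rad_pow {k A} n {X Y} f.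

Section InverseARTranslate.
Variables (k : fieldType) (A : falgType k).

(* D M = Hom_k(M, k), with (f x)(m) = f (x m) *)
Definition dual_mod (M : lmodule A) : lmodule (opp_alg A).
Proof.
refine (@LModule k (opp_alg A) 'Hom(M, k^o)
  (fun x f => (f \o act_lfun M (x : A))%VF) _ _ _ _).
- move=> f c x y; apply/lfunP=> m.
  by rewrite add_lfunE scale_lfunE !comp_lfunE !lfunE /= act_linearl linearP.
- by move=> x c f g; rewrite comp_lfunDl -comp_lfunZl.
- by move=> f; apply/lfunP=> m; rewrite comp_lfunE lfunE /= act1.
- move=> x y f; apply/lfunP=> m.
  by rewrite !comp_lfunE !lfunE /= opp_algM actM.
Defined.

Let regop : lmodule (opp_alg A) := regular_mod (opp_alg A).

Lemma transpose_closed (P : lmodule (opp_alg A)) (x : A)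
    (h : subvs_of (hom_space P regop)) :
  (amulr (x : opp_alg A) \o vsval h)%VF \in hom_space P regop.
Proof.
apply/hom_spaceP=> y m; rewrite !comp_lfunE !lfunE /=.
by rewrite (hom_in_space h y m) /= mulrA.
Qed.

(* P^t = Hom_(A^op)(P, A), with (x h)(p) = x h(p); in opp_alg A, left
   multiplication by x is amulr x. *)
Definition transpose_mod (P : lmodule (opp_alg A)) : lmodule A.
Proof.
refine (@LModule k A (subvs_of (hom_space P regop))
  (fun x h => vsproj (hom_space P regop)
                (amulr (x : opp_alg A) \o vsval h)%VF) _ _ _ _).
- move=> h c x y /=; rewrite -linearP /=; congr vsproj.
  apply/lfunP=> p; rewrite add_lfunE scale_lfunE !comp_lfunE !lfunE /=.
  by rewrite mulrDr scalerAr.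
- by move=> x c g h /=; rewrite comp_lfunDr -comp_lfunZr linearP.
- move=> h /=; apply/val_inj; rewrite /= vsprojK ?transpose_closed //.
  by apply/lfunP=> p; rewrite comp_lfunE lfunE /= mulr1.
- move=> x y h /=; congr vsproj; rewrite vsprojK ?transpose_closed //.
  by apply/lfunP=> p; rewrite !comp_lfunE !lfunE /= mulrA.
Defined.

(* f^t : P0^t -> P1^t is h |-> h f *)
Definition transpose_map (P1 P0 : lmodule (opp_alg A)) (f : 'Hom(P1, P0)) :
    'Hom(transpose_mod P0, transpose_mod P1) :=
  linfun (fun h : subvs_of (hom_space P0 regop) =>
            vsproj (hom_space P1 regop) (vsval h \o f)%VF).

Lemma transpose_mapE (P1 P0 : lmodule (opp_alg A)) (f : 'Hom(P1, P0))
    (h : transpose_mod P0) :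
  is_hom f -> vsval (transpose_map f h) = (vsval h \o f)%VF.
Proof.
move=> fA; pose t (h : subvs_of (hom_space P0 regop)) :=
  vsproj (hom_space P1 regop) (vsval h \o f)%VF.
have tL : linear t.
  by move=> c g1 g2; rewrite /t /= comp_lfunDl -comp_lfunZl linearP.
pose tS := GRing.isSemilinear.Build k _ _ _ t (GRing.semilinear_linear tL).
pose tl : {linear subvs_of (hom_space P0 regop) ->
                  subvs_of (hom_space P1 regop)} := HB.pack t tS.
rewrite /transpose_map (lfunE tl) /=; apply: vsprojK.
apply/(hom_spaceP (N := regop))=> x m.
by rewrite !comp_lfunE fA (hom_in_space h x).
Qed.

(* Y is Tr N: for a minimal projective presentation P1 -f-> P0 -> N -> 0 in
   mod A^op, the sequence P0^t -f^t-> P1^t -q-> Y -> 0 is exact. *)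
Definition is_Tr (N : lmodule (opp_alg A)) (Y : lmodule A) : Prop :=
  exists (P1 P0 : lmodule (opp_alg A)) (f : 'Hom(P1, P0)) (g : 'Hom(P0, N))
         (q : 'Hom(transpose_mod P1, Y)),
    [/\ minimal_projective_presentation f g, is_hom q,
        limg q = fullv & lker q = limg (transpose_map f)].

Definition is_inverse_AR_translate (M X : lmodule A) : Prop :=
  is_Tr (dual_mod M) X.

End InverseARTranslate.

Record quiver := Quiver {
  vertex : finType;
  arrow : finType;
  src : arrow -> vertex;
  tgt : arrow -> vertex }.

Section BoundQuiver.
Variables (k : fieldType) (Q : quiver).

Definition sink (a : vertex Q) : Prop := forall al : arrow Q, src al != a.

Fixpoint is_qpath (v : vertex Q) (s : seq (arrow Q)) : bool :=
  if s is al :: s' then (src al == v) && is_qpath (tgt al) s' else true.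

(* (v, s) is the path which starts at v and runs through the arrows of s from
   the first to the last; (v, [::]) is the trivial path at v. *)
Definition qpath := {p : vertex Q * seq (arrow Q) | is_qpath p.1 p.2}.

Definition trivial_path (v : vertex Q) : qpath :=
  exist (fun p => is_qpath p.1 p.2) (v, [::]) isT.

Definition psrc (p : qpath) : vertex Q := (val p).1.
Definition parrows (p : qpath) : seq (arrow Q) := (val p).2.
Definition ptgt (p : qpath) : vertex Q := last (psrc p) (map (@tgt Q) (parrows p)).
Definition plength (p : qpath) : nat := size (parrows p).

(* The product p q is "first q, then p", and it is None unless q ends where p
   starts. *)
Definition pcomp (p q : qpath) : option qpath :=
  if ptgt q == psrc p then (insub (psrc q, parrows q ++ parrows p) : option qpath) else None.

Lemma is_qpath_cat (v : vertex Q) (s t : seq (arrow Q)) :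
  is_qpath v (s ++ t) = is_qpath v s && is_qpath (last v (map (@tgt Q) s)) t.
Proof. by elim: s v => //= al s IHs v; rewrite IHs andbA. Qed.

Lemma pcompE (p q : qpath) : ptgt q = psrc p ->
  exists2 r, pcomp p q = Some r & val r = (psrc q, parrows q ++ parrows p).
Proof.
move=> qp; rewrite /pcomp qp eqxx; case: insubP => [r _ rE|]; first by exists r.
by rewrite /= is_qpath_cat -/(ptgt q) qp (valP p) andbT => /negP[]; exact: valP q.
Qed.

Definition kQ : lmodType k := {malg k[qpath]}.

Definition kQ_of_path (p : qpath) : kQ := mkmalgU p 1.

Definition kQ_mul (f g : kQ) : kQ :=
  \sum_(p <- msupp f) \sum_(q <- msupp g)
    if pcomp p q is Some r then (mcoeff p f * mcoeff q g) *: kQ_of_path r else 0.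

Definition kQ_one : kQ := \sum_(v : vertex Q) kQ_of_path (trivial_path v).

(* the n-th power of the arrow ideal *)
Definition arrow_ideal_pow (n : nat) (f : kQ) : Prop :=
  forall p, mcoeff p f != 0 -> (n <= plength p)%N.

Definition ideal_kQ (I : kQ -> Prop) : Prop :=
  [/\ I 0, forall c f g, I f -> I g -> I (c *: f + g)
    & forall f g, I g -> I (kQ_mul f g) /\ I (kQ_mul g f)].

Definition admissible (I : kQ -> Prop) : Prop :=
  [/\ ideal_kQ I, forall f, I f -> arrow_ideal_pow 2 f
    & exists m, (2 <= m)%N /\ forall f, arrow_ideal_pow m f -> I f].

(* pi induces an isomorphism of algebras from kQ / I onto A *)
Definition is_quotient_map (I : kQ -> Prop) (A : falgType k)
    (pi : {linear kQ -> A}) : Prop :=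
  [/\ pi kQ_one = 1, forall f g, pi (kQ_mul f g) = pi f * pi g,
      forall x, exists f, pi f = x & forall f, pi f = 0 <-> I f].

Section VertexModules.
Variables (A : falgType k) (pi : {linear kQ -> A}).

Definition vertex_idem (a : vertex Q) : A := pi (kQ_of_path (trivial_path a)).

Definition vertex_projective (a : vertex Q) : lmodule A :=
  principal_mod (vertex_idem a).

Definition is_vertex_simple (a : vertex Q) (S : lmodule A) : Prop :=
  simple_mod S /\ exists m : S, act (vertex_idem a) m != 0.

(* T = T[a] is the direct sum of tau^-1 (S_a) and the P_b, b != a. *)
Definition is_APR_tilting (a : vertex Q) (T : lmodule A) : Prop :=
  exists S X : lmodule A,
    [/\ is_vertex_simple a S, isomorphic (vertex_projective a) S,
        ~ injective_mod S, is_inverse_AR_translate S X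
      & is_direct_sum (fun b => if b == a then X else vertex_projective b) T].

End VertexModules.
End BoundQuiver.

(* phi is an isomorphism of algebras from B onto End_A(T), the product of
   End_A(T) being the composition of maps. *)
Definition is_End_algebra (k : fieldType) (A : falgType k) (T : lmodule A)
    (B : falgType k) (phi : {linear B -> 'End(T)}) : Prop :=
  [/\ injective phi, phi 1 = \1%VF,
      forall x y, phi (x * y) = (phi x \o phi y)%VF
    & forall f : 'End(T), is_hom f <-> exists x, phi x = f].

(* Main.v *)
Require Import Defs.
From HB Require Import structures.
From mathcomp Require Import all_boot all_order all_algebra all_field.
From mathcomp Require Import finmap monalg.
From Stdlib Require Import Classical.

Set Implicit Arguments.
Unset Strict Implicit.
Unset Printing Implicit Defensive.

Import GRing.Theory.
Local Open Scope ring_scope.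

(** Write ea for the idempotent of the sink a, e = 1 - ea, S = A ea for the
    simple projective module at a and W = tau^-1 S, so that T is the direct sum of
    W and A e. As a is a sink, x ea is a multiple of ea for every x in A.

    The powers of the radical are read off chains: Re^n (n >= 1) vanishes if and
    only if every composite of n radical maps is zero. Two facts about chains
    give r_A <= r_B.

    First, a nonzero chain of n radical maps in mod A can be replaced by one of
    the same length all of whose modules X are generated by e, that is
    X = A e X (rad_chain_generated). Every module is the direct sum of A e X and
    of copies of S, and a radical map cannot hit a copy of S, because S is
    projective. So S only matters as the source of a chain S -> Z -> ... -> Y.
    One may suppose Y indecomposable; the chain then sends S onto a line L in Y,
    and Y -> Y / L is radical. The chain Z -> ... -> Y -> Y / L has the same
    length and is not zero, as Z = A e Z has no nonzero map to L.

    Second, the functor Hom_A(T, -) is fully faithful on the modules with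
    X = A e X. It is faithful because A e is a summand of T. A B-linear map psi
    from Hom_A(T, X) to Hom_A(T, Y) must come from the h with
    h (u t) = (psi u) t, and the question is whether this is well defined. The
    component at e is settled by the summand A e of T. At ea one has to see that
    psi respects the relations sum_i al_i x_i = 0 where the al_i generate
    ea A e; all of them are images of one relation in W, which is the cokernel
    of a map from S to a projective module with the components al_i
    (sink_presentation), and psi respects maps out of W. Since B acts on Hom_A(T, X) from the right, its dual is used,
    which is a left B-module and contravariant in X. A map f is radical exactly
    when g f is nilpotent for all maps g back, so fully faithful functors
    preserve radical maps (dual_hom_map_Rad), and a nonzero chain in mod A as
    above yields a nonzero chain of the same length in mod B.

    It remains to see that r_B exists. If M is a B-module that contains every
    indecomposable module as a summand, chains factor through products of
    radical endomorphisms of M; these are nilpotent, and a space of nilpotent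
    endomorphisms that is closed under products is nilpotent
    (Rad_end_nilpotent). *)

(** * Linear algebra *)

Section LinearAlgebra.
Variable k : fieldType.
Implicit Types V W : vectType k.

Lemma linfun_apply V W (f : V -> W) : linear f -> forall v, linfun f v = f v.
Proof.
move=> fL v; pose fS := GRing.isSemilinear.Build k V W _ f
                          (GRing.semilinear_linear fL).
pose fl : {linear V -> W} := HB.pack f fS.
exact: (lfunE fl).
Qed.

Lemma linfun_exists V W (f : V -> W) :
  linear f -> exists F : 'Hom(V, W), forall v, F v = f v.
Proof. by move=> fL; exists (linfun f); apply: linfun_apply. Qed.

(** Among the subspaces inside p one of maximal dimension is all of p. *)
Lemma vspace_of_pred V (p : V -> Prop) :
  p 0 -> (forall c v w, p v -> p w -> p (c *: v + w)) ->
  exists U : {vspace V}, forall v, v \in U <-> p v.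
Proof.
move=> p0 pL.
have max d : (exists U : {vspace V}, forall v, v \in U <-> p v) \/
    exists U : {vspace V}, (d <= \dim U)%N /\ forall v, v \in U -> p v.
  elim: d => [|d [|[U [dU pU]]]]; [|by left|].
    by right; exists 0%VS; split=> // v /[!memv0] /eqP->.
  have [[v [pv vU]]|nov] := classic (exists v, p v /\ v \notin U); last first.
    left; exists U => v; split=> [/pU //|pv].
    by apply/negPn/negP=> vU; case: nov; exists v.
  right; exists (<[v]> + U)%VS; split.
    apply: leq_ltn_trans dU _; rewrite (ltn_leqif (dimv_leqif_sup (addvSr _ _))).
    by apply: contra vU => /subvP; apply; apply: subvP (addvSl _ _) _ (memv_line _).
  move=> w /memv_addP[_ /vlineP[c ->] [u /pU pu ->]]; exact: pL.
case: (max (\dim {:V}).+1) => // -[U [dU _]].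
by have := leq_trans dU (dimvS (subvf U)); rewrite ltnn.
Qed.

(** Images are chosen on a basis only; linearity of R does the rest. *)
Lemma linfun_of_graph V W (R : V -> W -> Prop) :
    (forall v, exists w, R v w) ->
    (forall c v w v' w', R v w -> R v' w' -> R (c *: v + v') (c *: w + w')) ->
    (forall w, R 0 w -> w = 0) ->
  exists h : 'Hom(V, W), forall v w, R v w -> h v = w.
Proof.
move=> Rtot RL Rfun.
have Runiq v w w' : R v w -> R v w' -> w = w'.
  move=> vw vw'; have := RL (-1) _ _ _ _ vw' vw.
  by rewrite !scaleN1r addNr addrC => /Rfun /eqP; rewrite subr_eq0 => /eqP.
have R0 : R 0 0.
  have [w vw] := Rtot 0; have := RL (-1) _ _ _ _ vw vw.
  by rewrite scaleN1r addNr scaleN1r addNr.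
have [y yP] := fin_all_exists (fun i : 'I_(\dim {:V}) => Rtot (vbasis {:V})`_i).
have [h hE] : exists h : 'Hom(V, W),
    forall v, h v = \sum_i coord (vbasis {:V}) i v *: y i.
  apply: linfun_exists => c v w; rewrite scaler_sumr -big_split /=.
  by apply: eq_bigr => i _; rewrite linearP scalerDl scalerA.
exists h => v w vw; apply: (Runiq v) => //; rewrite hE.
rewrite [X in R X _](coord_vbasis (memvf v)).
by elim/big_rec2: _ => // i x z _ xz; apply: RL.
Qed.

Lemma limg_fullP V W (f : 'Hom(V, W)) :
  limg f = fullv <-> forall w, exists v, w = f v.
Proof.
split=> [ff w|fS].
  have: w \in limg f by rewrite ff memvf.
  by move=> /memv_imgP[v _ ->]; exists v.
by apply/vspaceP=> w; rewrite memvf; have [v ->] := fS w; rewrite memv_img ?memvf.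
Qed.

Lemma dual_separates V (v : V) : (forall t : 'Hom(V, k^o), t v = 0) -> v = 0.
Proof.
move=> t0; rewrite (coord_vbasis (memvf v)) big1 // => i _.
have [t tE] : exists t : 'Hom(V, k^o),
    forall u, t u = coord (vbasis {:V}) i u.
  by apply: linfun_exists => c u w; rewrite linearP.
by rewrite -tE t0 scale0r.
Qed.

Lemma compl_proj0 V (U : {vspace V}) v : daddv_pi U^C U v = 0 <-> v \in U.
Proof.
have UC : (U :&: U^C)%VS = 0%VS := capv_compl U.
have CU : (U^C :&: U)%VS = 0%VS by rewrite capvC.
have vE : daddv_pi U^C U v + daddv_pi U U^C v = v.
  by apply: daddv_pi_add => //; rewrite addvC addv_complf memvf.
split=> [v0|vU]; first by rewrite -vE v0 add0r memv_pi.
by move: vE; rewrite (daddv_pi_id UC vU) => /(canRL (addrK v)); rewrite subrr.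
Qed.

Lemma functional_off V (U : {vspace V}) v : v \notin U ->
  exists t : 'Hom(V, k^o), t v = 1 /\ forall u, u \in U -> t u = 0.
Proof.
move=> /negP vU; apply: NNPP => not_t; apply/vU/compl_proj0/dual_separates => t.
apply/eqP/negPn/negP=> tv; apply: not_t.
exists ((t (daddv_pi U^C U v) : k)^-1 *: (t \o daddv_pi U^C U))%VF; split.
  by rewrite scale_lfunE comp_lfunE; apply: mulVf.
by move=> u /compl_proj0 u0; rewrite scale_lfunE comp_lfunE u0 linear0 scaler0.
Qed.

(** In coordinates F is a matrix, and f is its transpose. *)
Lemma dual_full V W (F : 'Hom('Hom(W, k^o), 'Hom(V, k^o))) :
  exists f : 'Hom(V, W), forall t, F t = (t \o f)%VF.
Proof.
have coordF (i : 'I_(\dim {:W})) : exists t : 'Hom(W, k^o),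
    forall u, t u = coord (vbasis {:W}) i u.
  by apply: linfun_exists => c u w; rewrite linearP.
have [t tE] := fin_all_exists coordF.
have [f fE] : exists f : 'Hom(V, W),
    forall v, f v = \sum_i (F (t i) v : k) *: (vbasis {:W})`_i.
  apply: linfun_exists => c u w; rewrite scaler_sumr -big_split /=.
  by apply: eq_bigr => i _; rewrite linearP scalerDl scalerA.
exists f => s; have -> : s = \sum_(i < \dim {:W}) (s (vbasis {:W})`_i : k) *: t i.
  apply/lfunP=> w; rewrite sum_lfunE {1}(coord_vbasis (memvf w)) linear_sum.
  apply: eq_bigr => i _; rewrite linearZ scale_lfunE tE.
  exact: mulrC.
rewrite linear_sum; apply/lfunP=> v; rewrite sum_lfunE comp_lfunE sum_lfunE.
apply: eq_bigr => i _; rewrite linearZ !scale_lfunE; congr (_ *: _).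
have Vfree : free (vbasis {:W}) := basis_free (vbasisP _).
rewrite tE fE linear_sum (bigD1 i) //= linearZ /= coord_free //.
rewrite eqxx big1 ?addr0 => [|j ji]; first by rewrite [RHS]mulr1.
rewrite linearZ /= coord_free //.
by rewrite (negPf ji) mulr0.
Qed.

End LinearAlgebra.

(** * Modules over a finite dimensional algebra *)

Section ModuleBasics.
Variables (k : fieldType) (A : falgType k).
Implicit Types (M N X Y Z : lmodule A) (x y : A) (c : k).

Lemma actDl M x y (m : M) : act (x + y) m = act x m + act y m.
Proof. by have := act_linearl m 1 x y; rewrite !scale1r. Qed.

Lemma act0l M (m : M) : act (0 : A) m = 0.
Proof. by apply: (addrI (act (0 : A) m)); rewrite -actDl !addr0. Qed.

Lemma actZl M c x (m : M) : act (c *: x) m = c *: act x m.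
Proof. by have := act_linearl m c x 0; rewrite act0l !addr0. Qed.

Lemma act_suml M (m : M) (J : finType) (x : J -> A) :
  act (\sum_j x j) m = \sum_j act (x j) m.
Proof.
by elim/big_rec2: _ => [|j y z _ <-]; [exact: act0l|exact: actDl].
Qed.

Lemma hom_exists M N (f : M -> N) :
    linear f -> (forall x m, f (act x m) = act x (f m)) ->
  exists F : 'Hom(M, N), is_hom F /\ forall m, F m = f m.
Proof.
move=> /linfun_exists[F FE] fA; exists F; split=> // x m.
by rewrite !FE fA.
Qed.

Lemma is_hom_id M : is_hom (\1 : 'End(M))%VF.
Proof. by move=> x m; rewrite !lfunE. Qed.

Lemma is_hom0 M N : is_hom (0 : 'Hom(M, N)).
Proof. by move=> x m; rewrite !zero_lfunE linear0. Qed.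

Lemma is_hom_comp X Y Z (g : 'Hom(Y, Z)) (f : 'Hom(X, Y)) :
  is_hom g -> is_hom f -> is_hom (g \o f)%VF.
Proof. by move=> gA fA x m; rewrite !comp_lfunE fA gA. Qed.

Lemma is_homP M N c (f g : 'Hom(M, N)) :
  is_hom f -> is_hom g -> is_hom (c *: f + g).
Proof.
by move=> fA gA x m; rewrite !add_lfunE !scale_lfunE fA gA linearP.
Qed.

Lemma is_homZ M N c (f : 'Hom(M, N)) : is_hom f -> is_hom (c *: f).
Proof. by move=> fA; rewrite -[_ *: _]addr0; apply: is_homP => //; exact: is_hom0. Qed.

Lemma is_homD M N (f g : 'Hom(M, N)) : is_hom f -> is_hom g -> is_hom (f + g).
Proof. by move=> fA gA; rewrite -[f]scale1r; apply: is_homP. Qed.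

Lemma hom_lift X N M (i : 'Hom(N, M)) (f : 'Hom(X, M)) :
    is_hom i -> injective i -> is_hom f -> (forall v, f v \in limg i) ->
  exists g : 'Hom(X, N), is_hom g /\ forall v, i (g v) = f v.
Proof.
move=> iA iI fA fi; exists (i^-1 \o f)%VF.
have gE v : i ((i^-1 \o f)%VF v) = f v by rewrite comp_lfunE limg_lfunVK.
by split=> // x m; apply: iI; rewrite iA !gE fA.
Qed.

Lemma hom_inv M N (f : 'Hom(M, N)) : is_iso f ->
  exists g : 'Hom(N, M),
    [/\ is_hom g, (g \o f)%VF = \1%VF & (f \o g)%VF = \1%VF].
Proof.
move=> [fA fb]; have fI := bij_inj fb.
have [|g [gA gE]] := hom_lift fA fI (@is_hom_id N).
  move=> n; rewrite lfunE /=; have [f' _ fK] := fb.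
  by rewrite -[n]fK memv_img // memvf.
exists g; split=> //; apply/lfunP=> m; rewrite comp_lfunE lfunE /=.
  by apply: fI; rewrite gE lfunE.
by rewrite gE lfunE.
Qed.

Lemma inj_end_iso M (f : 'End(M)) : is_hom f -> lker f = 0%VS -> is_iso f.
Proof.
move=> fA /eqP f0; split=> //; exists (f^-1)%VF => m.
  exact: lker0_lfunK.
exact: lker0_lfunVK.
Qed.

Lemma iso_of_inverse M N (f : 'Hom(M, N)) (g : 'Hom(N, M)) : is_hom f ->
  (g \o f)%VF = \1%VF -> (f \o g)%VF = \1%VF -> is_iso f.
Proof.
move=> fA /lfunP gf /lfunP fg; split=> //; exists g => m.
  by have := gf m; rewrite comp_lfunE lfunE.
by have := fg m; rewrite comp_lfunE lfunE.
Qed.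

Lemma submodule_mod M (U : {vspace M}) : submodule U ->
  exists (N : lmodule A) (i : 'Hom(N, M)),
    [/\ is_hom i, injective i, limg i = U & \dim {:N} = \dim U].
Proof.
move=> UA; pose a x (u : subvs_of U) := vsproj U (act x (vsval u)).
have aE x u : vsval (a x u) = act x (vsval u).
  by apply: vsprojK; apply: UA; apply: subvsP.
have aL u : linear (a^~ u).
  by move=> c x y; apply: val_inj; rewrite /= !aE act_linearl.
have aR x : linear (a x).
  by move=> c u v; apply: val_inj; rewrite /= !aE linearP.
have a1 u : a 1 u = u by apply: val_inj; rewrite /= aE act1.
have aM x y u : a (x * y) u = a x (a y u).
  by apply: val_inj; rewrite /= !aE actM.
pose N := @LModule k A (subvs_of U) a aL aR a1 aM.
have [i [iA iE]] : exists i : 'Hom(N, M), is_hom i /\ forall u : N, i u = vsval u.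
  apply: hom_exists => [c u v|x u] /=; [by []|exact: aE].
exists N, i; split=> //.
- by move=> u v; rewrite !iE => /val_inj.
- apply/vspaceP=> m; apply/memv_imgP/idP => [[u _ ->]|mU].
    by rewrite iE; apply: subvsP.
  by exists (vsproj U m); rewrite ?memvf // iE vsprojK.
by rewrite dimvf.
Qed.

Lemma quotient_mod M (U : {vspace M}) : submodule U ->
  exists (N : lmodule A) (p : 'Hom(M, N)),
    [/\ is_hom p, forall n, exists m, n = p m & forall m, p m = 0 <-> m \in U].
Proof.
(* The quotient is realised on a linear complement of U. *)
move=> UA; pose V := subvs_of U^C.
pose q (m : M) : V := vsproj U^C (daddv_pi U^C U m).
have qL : linear q by move=> c u v; rewrite /q !linearP.
have q0 m : q m = 0 <-> m \in U.
  rewrite -compl_proj0; split=> [/(congr1 vsval)|]; last by rewrite /q => ->; rewrite linear0.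
  by rewrite vsprojK ?memv_pi // linear0.
have [q' q'E] := linfun_exists qL.
have qV v : q (vsval v) = v.
  by rewrite /q daddv_pi_id ?vsvalK ?subvsP // capvC capv_compl.
have qD m n : q m = q n <-> m - n \in U.
  rewrite -q0 -!q'E; split=> [mn|/eqP]; first by rewrite linearB /= mn subrr.
  by rewrite linearB /= subr_eq0 => /eqP.
pose a x (v : V) := q (act x (vsval v)).
have aq x m : a x (q m) = q (act x m).
  by apply/qD; rewrite -linearB; apply/UA/qD; rewrite qV.
have aL u : linear (a^~ u).
  by move=> c x y; rewrite /a act_linearl qL.
have aR x : linear (a x).
  by move=> c u v; rewrite /a /= act_linearr qL.
have a1 u : a 1 u = u by rewrite /a act1 qV.
have aM x y u : a (x * y) u = a x (a y u).
  by rewrite /a actM -/(a x _) -aq.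
pose N := @LModule k A V a aL aR a1 aM.
have [p [pA pE]] : exists p : 'Hom(M, N), is_hom p /\ forall m, p m = q m.
  by apply: hom_exists => // x m; rewrite /= aq.
exists N, p; split=> // [n|m]; last by rewrite pE.
by exists (vsval n); rewrite pE qV.
Qed.

End ModuleBasics.

(** * The radical and nilpotent endomorphisms *)

Section Powers.
Variables (k : fieldType) (V : vectType k).
Implicit Types f : 'End(V).

Definition lpow f n : 'End(V) := iter n (comp_lfun f) \1%VF.

Lemma lpowS f n v : lpow f n.+1 v = f (lpow f n v).
Proof. by rewrite /lpow /= comp_lfunE. Qed.

Lemma lpowSr f n v : lpow f n.+1 v = lpow f n (f v).
Proof.
elim: n v => [|n IHn] v; first by rewrite lpowS !lfunE.
by rewrite lpowS IHn -lpowS.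
Qed.

(** Fitting's lemma: the images of the powers of f shrink until f maps one of
    them, U, onto itself, and a surjective endomorphism of U is injective. *)
Lemma fitting f : exists n,
  [/\ f @: limg (lpow f n) = limg (lpow f n),
      limg (lpow f n) :&: lker f = 0
    & limg (lpow f n) :&: lker (lpow f n) = 0]%VS.
Proof.
have imS n : limg (lpow f n.+1) = (f @: limg (lpow f n))%VS.
  by rewrite -limg_comp.
have im_le n : (limg (lpow f n.+1) <= limg (lpow f n))%VS.
  apply/subvP=> v /memv_imgP[u _ ->]; rewrite lpowSr; exact: memv_img (memvf _).
have [n fU] : exists n, limg (lpow f n.+1) = limg (lpow f n).
  apply: NNPP => neq.
  have lt n : (\dim (limg (lpow f n)) + n <= \dim {:V})%N.
    elim: n => [|n IHn]; first by rewrite addn0 dimvS ?subvf.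
    apply: leq_trans IHn; rewrite addnS ltn_add2r.
    rewrite (ltn_leqif (dimv_leqif_sup (im_le n))).
    by apply/negP=> le; case: neq; exists n; apply: subv_anti; rewrite im_le.
  by have := leq_trans (leq_addl _ _) (lt (\dim {:V}).+1); rewrite ltnn.
rewrite imS in fU; exists n; split=> //.
  apply/eqP; rewrite -dimv_eq0 -(eqn_add2r (\dim (f @: limg (lpow f n)))).
  by rewrite limg_ker_dim fU eqxx.
have gU : (lpow f n @: limg (lpow f n) = limg (lpow f n))%VS.
  elim: {1}n => [|m IHm]; first by rewrite lim1g.
  by rewrite [lpow f m.+1]/(f \o lpow f m)%VF limg_comp IHm.
apply/eqP; rewrite -dimv_eq0 -(eqn_add2r (\dim (lpow f n @: limg (lpow f n)))).
by rewrite limg_ker_dim gU eqxx.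
Qed.

End Powers.

Section Radical.
Variables (k : fieldType) (A : falgType k).
Implicit Types (M N X Y Z : lmodule A).

Lemma is_hom_lpow M (f : 'End(M)) n : is_hom f -> is_hom (lpow f n).
Proof.
move=> fA; elim: n => [|n IHn]; first exact: is_hom_id.
exact: is_hom_comp.
Qed.

Lemma submodule_img M N (f : 'Hom(M, N)) : is_hom f -> submodule (limg f).
Proof.
by move=> fA x n /memv_imgP[m _ ->]; rewrite -fA memv_img ?memvf.
Qed.

Lemma submodule_ker M N (f : 'Hom(M, N)) : is_hom f -> submodule (lker f).
Proof.
by move=> fA x m; rewrite !memv_ker fA => /eqP->; rewrite linear0.
Qed.

(** By Fitting's lemma M is the direct sum of the image and the kernel of a power
    of f, so that one of them is zero. *)
Lemma indecomposable_end M (f : 'End(M)) : indecomposable M -> is_hom f ->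
  is_iso f \/ exists n, lpow f n = 0.
Proof.
move=> [_ Mind] fA; have [n [_ Uf0 UW0]] := fitting f.
have gA := is_hom_lpow n fA.
have := Mind _ _ (submodule_img gA) (submodule_ker gA).
case=> // [|U0|W0].
- apply/eqP; rewrite eqEdim subvf dimv_disjoint_sum // addnC.
  by rewrite -[X in (X <= _)%N](limg_ker_dim (lpow f n) fullv) capfv leqnn.
- right; exists n; apply/lfunP=> m; apply/eqP.
  by rewrite zero_lfunE -memv0 -U0 memv_img ?memvf.
- by left; apply: inj_end_iso => //; rewrite -Uf0 lker0_limgf ?capfv ?W0.
Qed.

(** This replaces a decomposition 1 = sum_j s_j r_j of the identity of X through
    indecomposable modules: v is the sum of its components s_j (r_j v), and a
    property that is stable under sums need only be checked on those. *)
Lemma indecomposable_summands_ind X (v : X) (p : X -> Prop) :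
    p 0 -> (forall u w, p u -> p w -> p (u + w)) ->
    (forall Z (r : 'Hom(X, Z)) (s : 'Hom(Z, X)), indecomposable Z ->
       is_hom r -> is_hom s -> (r \o s)%VF = \1%VF -> p (s (r v))) ->
  p v.
Proof.
have [n] := ubnP (\dim {:X}); elim: n X v p => // n IHn X v p dX p0 pD pZ.
have [X0|Xn0] := eqVneq (fullv : {vspace X}) 0%VS.
  by have := memvf v; rewrite X0 memv0 => /eqP->.
have [Xind|Xdec] := classic (indecomposable X).
  have /= := pZ X \1%VF \1%VF Xind (@is_hom_id _ _ X) (@is_hom_id _ _ X).
  by rewrite comp_lfun1l !lfunE; apply.
have [U [W [UA WA UW UW0 [/eqP Un0 /eqP Wn0]]]] :
    exists U W : {vspace X}, [/\ submodule U, submodule W, (U + W)%VS = fullv,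
      (U :&: W)%VS = 0%VS & U <> 0%VS /\ W <> 0%VS].
  apply: NNPP => no; apply: Xdec; split=> // U W UA WA UW UW0.
  have [U0|Un0] := classic (U = 0%VS); [by left|right].
  by apply: NNPP => Wn0; apply: no; exists U, W.
have WU0 : (W :&: U)%VS = 0%VS by rewrite capvC.
have dUW : (\dim U + \dim W)%N = \dim {:X} by rewrite -UW dimv_disjoint_sum.
rewrite -(daddv_pi_add (w := v) UW0) ?UW ?memvf //.
have part (S S' : {vspace X}) : submodule S -> submodule S' ->
    (S + S')%VS = fullv -> (S :&: S')%VS = 0%VS -> (\dim S < \dim {:X})%N ->
    p (daddv_pi S S' v).
  move=> SA S'A SS SS0 dS; have S'S0 : (S' :&: S)%VS = 0%VS by rewrite capvC.
  have piA : is_hom (daddv_pi S S' : 'End(X)).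
    move=> x m; have mE := daddv_pi_add (w := m) SS0.
    rewrite SS memvf in mE; rewrite -[in LHS](mE isT) 2!linearD /=.
    rewrite (daddv_pi_id SS0 (SA x _ (memv_pi S S' m))).
    have := daddv_pi_add (w := act x (daddv_pi S' S m)) SS0.
    rewrite SS memvf (daddv_pi_id S'S0 (S'A x _ (memv_pi S' S m))) => /(_ isT).
    by move/(canRL (addrK _)); rewrite subrr => ->; rewrite addr0.
  have [N [i [iA iI iS dN]]] := submodule_mod SA.
  have [|q [qA qE]] := hom_lift iA iI piA; first by move=> u; rewrite iS memv_pi.
  have qi : (q \o i)%VF = \1%VF.
    apply/lfunP=> m; apply: iI; rewrite comp_lfunE qE lfunE /= daddv_pi_id //.
    by rewrite -iS memv_img ?memvf.
  rewrite -qE; apply: (IHn N (q v) (p \o i)) => /=.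
  - by rewrite dN (leq_trans dS).
  - by rewrite linear0.
  - by move=> u w pu pw; rewrite linearD; apply: pD.
  move=> Z r s Zind rA sA rs.
  have := pZ Z (r \o q)%VF (i \o s)%VF Zind (is_hom_comp rA qA) (is_hom_comp iA sA).
  rewrite !comp_lfunE; apply.
  by rewrite comp_lfunA -(comp_lfunA r) qi comp_lfun1r.
apply: pD; apply: part => //; rewrite ?[(W + U)%VS]addvC //.
  by rewrite -dUW -[X in (X < _)%N]addn0 ltn_add2l lt0n dimv_eq0.
by rewrite -dUW -[X in (X < _)%N]add0n ltn_add2r lt0n dimv_eq0.
Qed.

Lemma indecomposable_summand X : (fullv : {vspace X}) != 0%VS ->
  exists Z (r : 'Hom(X, Z)) (s : 'Hom(Z, X)),
    [/\ indecomposable Z, is_hom r, is_hom s & (r \o s)%VF = \1%VF].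
Proof.
move=> X0; apply: NNPP => no; case/negP: X0; rewrite -subv0.
apply/subvP=> v _; rewrite memv0; apply/eqP.
apply: (indecomposable_summands_ind (p := fun v => v = 0)) => //.
  by move=> u w -> ->; rewrite addr0.
by move=> Z r s Zind rA sA rs; case: no; exists Z, r, s.
Qed.

Lemma Rad_hom X Y (f : 'Hom(X, Y)) : Rad f -> is_hom f.
Proof. by case. Qed.

Lemma Rad_comp X X' Y Y' (f : 'Hom(X, Y)) (u : 'Hom(X', X)) (v : 'Hom(Y, Y')) :
  Rad f -> is_hom u -> is_hom v -> Rad (v \o (f \o u))%VF.
Proof.
move=> [fA frad] uA vA; split; first by do 2?apply: is_hom_comp.
move=> M h h' Mind hA h'A.
have := frad M (u \o h)%VF (h' \o v)%VF Mind (is_hom_comp uA hA) (is_hom_comp h'A vA).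
by rewrite !comp_lfunA.
Qed.

Lemma Rad_compl X Y Y' (f : 'Hom(X, Y)) (v : 'Hom(Y, Y')) :
  Rad f -> is_hom v -> Rad (v \o f)%VF.
Proof. by move=> /Rad_comp/(_ (@is_hom_id _ _ X)) h /h; rewrite comp_lfun1r. Qed.

Lemma Rad_compr X X' Y (f : 'Hom(X, Y)) (u : 'Hom(X', X)) :
  Rad f -> is_hom u -> Rad (f \o u)%VF.
Proof.
by move=> fR uA; have := Rad_comp fR uA (@is_hom_id _ _ Y); rewrite comp_lfun1l.
Qed.

Lemma RadZ X Y c (f : 'Hom(X, Y)) : Rad f -> Rad (c *: f).
Proof.
move=> fR; have := Rad_compr fR (is_homZ c (@is_hom_id _ _ X)).
by rewrite -comp_lfunZr comp_lfun1r.
Qed.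

(** If a + b is an automorphism of an indecomposable module, so is a or b:
    after composing with an inverse, a = 1 - b is invertible as soon as b is
    nilpotent. *)
Lemma local_end M (a b : 'End(M)) : indecomposable M -> is_hom a -> is_hom b ->
  is_iso (a + b) -> is_iso a \/ is_iso b.
Proof.
move=> Mind aA bA ab; have [t [tA tab abt]] := hom_inv ab.
have [tb|[n tb0]] := indecomposable_end Mind (is_hom_comp tA bA).
  right; have [u [uA utb tbu]] := hom_inv tb.
  apply: inj_end_iso => //; apply/eqP; rewrite -subv0; apply/subvP=> m.
  rewrite memv_ker => /eqP bm; have /lfunP/(_ m) := utb.
  by rewrite !comp_lfunE bm !linear0 lfunE /= => <-; rewrite memv0.
left; apply: inj_end_iso => //; apply/eqP; rewrite -subv0; apply/subvP=> m.
rewrite memv_ker => /eqP am; have tbm : (t \o b)%VF m = m.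
  by have /lfunP/(_ m) := tab; rewrite !comp_lfunE add_lfunE am add0r lfunE.
have : lpow (t \o b)%VF n m = m by elim: n {tb0} => [|n IHn]; [rewrite lfunE|rewrite lpowS IHn].
by rewrite tb0 zero_lfunE => <-; rewrite memv0.
Qed.

Lemma RadD X Y (f g : 'Hom(X, Y)) : Rad f -> Rad g -> Rad (f + g).
Proof.
move=> [fA frad] [gA grad]; split; first exact: is_homD.
move=> M h h' Mind hA h'A; rewrite comp_lfunDl comp_lfunDr.
have homh (e : 'Hom(X, Y)) : is_hom e -> is_hom (h' \o (e \o h))%VF.
  by move=> eA; do 2?apply: is_hom_comp.
case/(local_end Mind (homh f fA) (homh g gA)); [exact: frad|exact: grad].
Qed.

(** If f were not nilpotent, it would permute the image U of one of its powers,
    and an indecomposable summand of U would contradict f being radical. *)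
Lemma Rad_nilpotent X (f : 'End(X)) : Rad f -> exists n, lpow f n = 0.
Proof.
move=> [fA frad]; have [n [fU Uf0 Ug0]] := fitting f; exists n.
have gA := is_hom_lpow n fA; set g := lpow f n in fU Uf0 Ug0 gA *.
have [U0|Un0] := eqVneq (limg g) 0%VS.
  by apply/lfunP=> v; apply/eqP; rewrite zero_lfunE -memv0 -U0 memv_img ?memvf.
have [N [i [iA iI iU dN]]] := submodule_mod (submodule_img gA).
have [|q [qA qE]] := hom_lift iA iI gA; first by move=> v; rewrite iU memv_img ?memvf.
have Nn0 : (fullv : {vspace N}) != 0%VS by rewrite -dimv_eq0 dN dimv_eq0.
have [M [r [s [Mind rA sA rs]]]] := indecomposable_summand Nn0.
have psiA : is_hom (q \o (f \o i))%VF by do 2?apply: is_hom_comp.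
have inU m : i m \in limg g by rewrite -iU memv_img ?memvf.
have /hom_inv[t [tA tpsi _]] : is_iso (q \o (f \o i))%VF.
  apply: inj_end_iso => //; apply/eqP; rewrite -subv0; apply/subvP=> m.
  rewrite memv_ker !comp_lfunE => /eqP/(congr1 i); rewrite qE linear0 => gfi.
  have : f (i m) \in (limg g :&: lker g)%VS.
    by rewrite memv_cap memv_ker gfi eqxx -fU memv_img.
  rewrite Ug0 => /[!memv0]/eqP fi0.
  have : i m \in (limg g :&: lker f)%VS by rewrite memv_cap memv_ker fi0 inU eqxx.
  rewrite Uf0 => /[!memv0]/eqP im0; apply/eqP/iI.
  by rewrite im0 linear0.
(* t inverts the automorphism q f i of U that f induces, up to a power of f. *)
case: (frad M (i \o s)%VF (r \o (t \o q))%VF) => //; try by do 2?apply: is_hom_comp.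
have -> : ((r \o (t \o q)) \o (f \o (i \o s)) = \1)%VF.
  rewrite -rs -[in RHS](comp_lfun1l s) -tpsi.
  by rewrite !comp_lfunA.
by apply: (iso_of_inverse (g := \1%VF)) (@is_hom_id _ _ M) _ _; rewrite comp_lfun1l.
Qed.

(** If h' f h = t^-1 were invertible, then g = h t h' would satisfy g f h = h, and
    g f could not be nilpotent. *)
Lemma nilpotent_Rad X Y (f : 'Hom(X, Y)) : is_hom f ->
  (forall g : 'Hom(Y, X), is_hom g -> exists n, lpow (g \o f)%VF n = 0) ->
  Rad f.
Proof.
move=> fA fnil; split=> // M h h' [Mn0 _] hA h'A /hom_inv[t [tA tE _]].
have [n gf0] := fnil (h \o (t \o h'))%VF ltac:(by do 2?apply: is_hom_comp).
case/negP: Mn0; rewrite -subv0; apply/subvP=> m _; rewrite memv0.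
have gfh : ((h \o (t \o h')) \o f)%VF (h m) = h m.
  have /lfunP/(_ m) := tE; rewrite !comp_lfunE lfunE /= => -> //.
have : lpow ((h \o (t \o h')) \o f)%VF n (h m) = h m.
  by elim: n {gf0} => [|n IHn]; [rewrite lfunE|rewrite lpowS IHn].
rewrite gf0 zero_lfunE => hm0.
by have /lfunP/(_ m) := tE; rewrite !comp_lfunE -hm0 !linear0 lfunE /= => <-.
Qed.

End Radical.

(** * Chains of radical maps *)

Section Chains.
Variables (k : fieldType) (A : falgType k) (C : lmodule A -> Prop).
Implicit Types (M N X Y Z : lmodule A).

(** A chain of length 0 is an arbitrary map, not an identity. As the radical is
    an ideal this does not matter from length 1 on, and radical maps can be split
    off at either end without a special case. *)
Fixpoint rad_chain n X Y (f : 'Hom(X, Y)) : Prop :=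
  match n with
  | 0 => [/\ C X, C Y & is_hom f]
  | n'.+1 => exists Z (g : 'Hom(X, Z)) (h : 'Hom(Z, Y)),
      [/\ rad_chain n' g, C Y, Rad h & f = (h \o g)%VF]
  end.

Lemma rad_chain_hom n X Y (f : 'Hom(X, Y)) :
  rad_chain n f -> [/\ C X, C Y & is_hom f].
Proof.
elim: n X Y f => [|n IHn] X Y f //= [Z [g [h [/IHn[CX _ gA] CY hR ->]]]].
by split=> //; apply: is_hom_comp (Rad_hom hR) gA.
Qed.

Lemma rad_chain_compl n X Y Y' (f : 'Hom(X, Y)) (u : 'Hom(Y, Y')) :
  rad_chain n f -> C Y' -> is_hom u -> rad_chain n (u \o f)%VF.
Proof.
case: n => [|n] /= fch CY' uA; first by case: fch => *; split=> //; apply: is_hom_comp.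
have [Z [g [h [gch CY hR ->]]]] := fch; exists Z, g, (u \o h)%VF.
by split=> //; [apply: Rad_compl|rewrite comp_lfunA].
Qed.

Lemma rad_chain_front n X Y (f : 'Hom(X, Y)) : rad_chain n.+1 f ->
  exists Z (h : 'Hom(X, Z)) (g : 'Hom(Z, Y)),
    [/\ C X, Rad h, rad_chain n g & f = (g \o h)%VF].
Proof.
elim: n Y f => [|n IHn] Y f [Z [g [h [gch CY hR ->]]]].
  have [CX CZ gA] := gch; exists Y, (h \o g)%VF, \1%VF.
  split=> //; [exact: Rad_compr|split=> //; exact: is_hom_id|].
  by rewrite comp_lfun1l.
have [Z' [h' [g' [CX h'R g'ch ->]]]] := IHn _ _ gch.
exists Z', h', (h \o g')%VF; split=> //; last by rewrite comp_lfunA.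
by exists Z, g', h.
Qed.

Lemma rad_chain_back n X Z Y (h : 'Hom(X, Z)) (g : 'Hom(Z, Y)) :
  C X -> Rad h -> rad_chain n g -> rad_chain n.+1 (g \o h)%VF.
Proof.
move=> CX hR; elim: n Y g => [|n IHn] Y g /=.
  move=> [CZ CY gA]; exists X, \1%VF, (g \o h)%VF.
  by split=> //; [split=> //; exact: is_hom_id|exact: Rad_compl|rewrite comp_lfun1r].
move=> [Z' [g' [h' [g'ch CY h'R ->]]]]; exists Z', (g' \o h)%VF, h'.
by split=> //; [exact: IHn|rewrite comp_lfunA].
Qed.

Lemma rad_chain_pow n X Y (f : 'Hom(X, Y)) : rad_chain n.+1 f -> Rad_pow n.+1 f.
Proof.
elim: n Y f => [|n IHn] Y f [Z [g [h [gch CY hR ->]]]].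
  by case: gch => _ _ gA; apply: Rad_compr.
exists 1%N, (fun=> Z), (fun=> g), (fun=> h); split; last by rewrite big_ord1.
by move=> _; split=> //; apply: IHn.
Qed.

End Chains.

Section ChainsPowers.
Variables (k : fieldType) (A : falgType k).
Implicit Types (M N X Y Z : lmodule A).

Definition any_module M := True.

(** A nonzero sum of composites has a nonzero summand. *)
Lemma rad_pow_chain n X Y (f : 'Hom(X, Y)) : Rad_pow n.+1 f -> f <> 0 ->
  exists f' : 'Hom(X, Y), rad_chain any_module n.+1 f' /\ f' <> 0.
Proof.
move=> fn f0.
have [v fv] : exists v, f v != 0.
  apply: NNPP => no; apply: f0; apply/lfunP=> v; rewrite zero_lfunE.
  by apply/eqP/negPn/negP=> fv; apply: no; exists v.
(* u stands for the maps that follow: the summand that is selected has to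
   survive them. *)
have gen n' Y' (f' : 'Hom(X, Y')) (u : 'Hom(Y', Y)) : Rad_pow n'.+1 f' -> u (f' v) != 0 ->
    exists f'' : 'Hom(X, Y'), rad_chain any_module n'.+1 f'' /\ u (f'' v) != 0.
  elim: n' Y' f' u => [|n' IHn] Y' f' u /=.
    move=> fR ufv; exists f'; split=> //; exists X, \1%VF, f'.
    by split=> //; [split=> //; exact: is_hom_id|rewrite comp_lfun1r].
  move=> [r [Z [g [h [gh ->]]]]]; rewrite sum_lfunE linear_sum /= => ufv.
  have [i ui] : exists i, u ((h i \o g i)%VF v) != 0.
    apply: NNPP => no; case/negP: ufv; apply/eqP; apply: big1 => i _.
    by apply/eqP/negPn/negP=> ui; apply: no; exists i.
  have [gn hR] := gh i; rewrite comp_lfunE -comp_lfunE in ui.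
  have [g' [g'ch ug']] := IHn _ _ _ gn ui.
  exists (h i \o g')%VF; split; last by rewrite comp_lfunE -comp_lfunE.
  by exists (Z i), g', (h i).
have [|f' [f'ch f'v]] := gen n Y f \1%VF fn; first by rewrite lfunE.
exists f'; split=> // f'0; case/negP: f'v.
by rewrite f'0 zero_lfunE linear0.
Qed.

Lemma Rad_pow_zero_chains n : Rad_pow_zero A n.+1 <->
  forall X Y (f : 'Hom(X, Y)), rad_chain any_module n.+1 f -> f = 0.
Proof.
split=> [zn X Y f fch|zch X Y f fn]; first exact/zn/rad_chain_pow/fch.
apply: NNPP => f0; have [f' [f'ch]] := rad_pow_chain fn f0.
by case; apply: zch f'ch.
Qed.

Lemma nilpotency_index_exists n :
  Rad_pow_zero A n.+1 -> exists r, is_nilpotency_index A r.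
Proof.
have [m] := ubnP n; elim: m n => // m IHm n nm An.
have [[n' [n'n An']]|no] := classic (exists n', (n' < n)%N /\ Rad_pow_zero A n'.+1).
  by apply: IHm An'; apply: leq_trans n'n _.
exists n.+1; split=> // -[//|n'] _ An'; rewrite ltnS leqNgt; apply/negP=> n'n.
by apply: no; exists n'.
Qed.

End ChainsPowers.

(** * Nilpotency of the radical in the representation-finite case *)

Section RepresentationFinite.
Variables (k : fieldType) (A : falgType k).
Implicit Types (M N X Y Z : lmodule A).

Fixpoint killed M n (m : M) : Prop :=
  match n with
  | 0 => m = 0
  | n'.+1 => forall j : 'End(M), Rad j -> killed n' (j m)
  end.

Lemma killed0 M n : killed n (0 : M).
Proof. by elim: n => //= n IHn j _; rewrite linear0. Qed.

Lemma killedP M n c (m m' : M) : killed n m -> killed n m' -> killed n (c *: m + m').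
Proof.
elim: n m m' => [|n IHn] m m' /=; first by move=> -> ->; rewrite scaler0 addr0.
by move=> km km' j jR; rewrite linearP; apply: IHn; [exact: km|exact: km'].
Qed.

Lemma killed_leq M n n' (m : M) : (n <= n')%N -> killed n m -> killed n' m.
Proof.
elim: n n' m => [|n IHn] n' m le; first by move=> ->; exact: killed0.
by case: n' le => // n' le km j jR; apply: IHn (km j jR).
Qed.

(** For u <> 0 the subspace J u, where J consists of the radical endomorphisms,
    does not contain u, as the elements of J are nilpotent. So J u is smaller
    than any J-stable subspace containing u, and induction on the dimension
    applies. *)
Lemma Rad_end_nilpotent M : exists n, forall m : M, killed n m.
Proof.
have stable d (U : {vspace M}) : (\dim U < d)%N ->
    (forall j : 'End(M), Rad j -> forall u, u \in U -> j u \in U) ->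
  exists n, forall u, u \in U -> killed n u.
  elim: d U => // d IHd U dU UJ.
  have each u : u \in U -> exists n, killed n u.
    move=> uU; have [->|u0] := eqVneq u 0; first by exists 0%N.
    have [||W WE] := @vspace_of_pred _ M (fun w => exists2 j : 'End(M), Rad j & w = j u).
    - exists 0; last by rewrite zero_lfunE.
      apply: (nilpotent_Rad (@is_hom0 _ _ M M)) => g _; exists 1%N; apply/lfunP=> v.
      by rewrite lpowS comp_lfun0r !zero_lfunE.
    - move=> c v w [j jR ->] [j' j'R ->]; exists (c *: j + j').
        exact: RadD (RadZ c jR) j'R.
      by rewrite add_lfunE scale_lfunE.
    have [||n nW] := IHd W.
    - rewrite ltnS in dU; apply: leq_trans dU.
      have WU : (W <= U)%VS by apply/subvP=> w /WE[j jR ->]; exact: UJ.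
      rewrite (ltn_leqif (dimv_leqif_sup WU)); apply/negP=> /subvP/(_ u uU)/WE[j jR uj].
      have [n jn] := Rad_nilpotent jR.
      have : lpow j n u = u by elim: n {jn} => [|n IHn]; [rewrite lfunE|rewrite lpowS IHn].
      by rewrite jn zero_lfunE => u0'; rewrite -u0' eqxx in u0.
    - move=> j jR w /WE[j' j'R ->]; apply/WE; exists (j \o j')%VF.
        exact: Rad_compl j'R (Rad_hom jR).
      by rewrite comp_lfunE.
    by exists n.+1 => j jR; apply: nW; apply/WE; exists j.
  have [n nP] := fin_all_exists (fun i : 'I_(\dim U) => each _ (vbasis_mem (mem_tnth i (vbasis U)))).
  exists (\max_i n i)%N => u uU; rewrite (coord_vbasis uU).
  elim/big_rec: (\sum_i _) => [|i v _]; first exact: killed0.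
  apply: killedP; apply: killed_leq (leq_bigmax i) _.
  by have := nP i; rewrite (tnth_nth 0).
have [|n nP] := stable (\dim {:M}).+1 fullv (leqnn _); first by move=> *; rewrite memvf.
by exists n => m; apply: nP; rewrite memvf.
Qed.

Lemma direct_sum_mod M N : exists (P : lmodule A) (i : 'Hom(M, P)) (j : 'Hom(N, P))
    (p : 'Hom(P, M)) (q : 'Hom(P, N)),
  [/\ is_hom i /\ is_hom j, is_hom p /\ is_hom q,
      (p \o i)%VF = \1%VF & (q \o j)%VF = \1%VF].
Proof.
pose V : vectType k := (M * N)%type.
pose a (x : A) (v : V) : V := (act x v.1, act x v.2).
have aL u : linear (a^~ u) by move=> c x y; rewrite /a !act_linearl.
have aR x : linear (a x) by move=> c u v; rewrite /a !linearP.
have a1 u : a 1 u = u by rewrite /a !act1; case: u.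
have aM x y u : a (x * y) u = a x (a y u) by rewrite /a !actM.
pose P := @LModule k A V a aL aR a1 aM.
have [||i [iA iE]] := @hom_exists _ _ M P (fun m => (m, 0)).
- by move=> c u v; congr pair; rewrite /= scaler0 addr0.
- by move=> x m; congr pair; rewrite /= linear0.
have [||j [jA jE]] := @hom_exists _ _ N P (fun n => (0, n)).
- by move=> c u v; congr pair; rewrite /= scaler0 addr0.
- by move=> x m; congr pair; rewrite /= linear0.
have [//|//|p [pA pE]] := @hom_exists _ _ P M fst.
have [//|//|q [qA qE]] := @hom_exists _ _ P N snd.
exists P, i, j, p, q; split=> //; apply/lfunP=> v; rewrite comp_lfunE !lfunE /=.
  by rewrite pE iE.
by rewrite qE jE.
Qed.

Definition retract M N :=
  exists (i : 'Hom(M, N)) (p : 'Hom(N, M)),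
    [/\ is_hom i, is_hom p & (p \o i)%VF = \1%VF].

Lemma retract_trans M N P : retract M N -> retract N P -> retract M P.
Proof.
move=> [i [p [iA pA pi]]] [j [q [jA qA qj]]]; exists (j \o i)%VF, (p \o q)%VF.
split; [exact: is_hom_comp..|].
by rewrite comp_lfunA -(comp_lfunA p) qj comp_lfun1r.
Qed.

Lemma common_module n (L : 'I_n -> lmodule A) : exists M, forall i, retract (L i) M.
Proof.
elim: n L => [|n IHn] L; first by exists (regular_mod A) => -[].
have [M LM] := IHn (fun i => L (lift ord_max i)).
have [P [i [j [p [q [[iA jA] [pA qA] pi qj]]]]]] := direct_sum_mod M (L ord_max).
exists P => l; case: (unliftP ord_max l) => [l'|] ->.
  by apply: retract_trans (LM l') _; exists i, p.
by exists j, q.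
Qed.

(** The sum of the modules in the list for A contains every indecomposable as a
    summand. *)
Lemma representation_finite_retracts : representation_finite A ->
  exists M, forall Z, indecomposable Z -> retract Z M.
Proof.
move=> [n [L Lind]]; have [M LM] := common_module L; exists M => Z /Lind[i [f fiso]].
apply: retract_trans (LM i); have [g [gA gf _]] := hom_inv fiso.
by exists f, g; case: fiso.
Qed.

(** Let M contain all indecomposable modules as summands. Writing the identities
    of the modules in a chain as sums of maps through M turns its composite into
    a sum of products of radical endomorphisms of M, and long products of those
    vanish. *)
Lemma representation_finite_Rad_pow_zero : representation_finite A ->
  exists n, Rad_pow_zero A n.+1.
Proof.
move=> /representation_finite_retracts[M MP]; have [n nM] := Rad_end_nilpotent M.
exists n; apply/Rad_pow_zero_chains => X Y f fch.
have via m X' Y' (f' : 'Hom(X', Y')) (s : 'Hom(M, X')) (w : M) :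
    rad_chain (@any_module _ A) m f' -> is_hom s -> killed m w -> f' (s w) = 0.
  elim: m X' Y' f' s w => [|m IHm] X' Y' f' s w.
    by move=> _ _ /= ->; rewrite !linear0.
  move=> /rad_chain_front[Z [h [g [_ hR gch ->]]]] sA kw; rewrite comp_lfunE.
  apply: (indecomposable_summands_ind (v := h (s w)) (p := fun z => g z = 0)).
  - exact: linear0.
  - by move=> u u' gu gu'; rewrite linearD /= gu gu' addr0.
  move=> Z' r i Zind rA iA ri; have [j [p [jA pA pj]]] := MP _ Zind.
  have -> : i (r (h (s w))) = (i \o p)%VF ((j \o r \o h \o s)%VF w).
    rewrite !comp_lfunE; congr (i _).
    by have /lfunP/(_ (r (h (s w)))) := pj; rewrite comp_lfunE lfunE.
  apply: IHm gch (is_hom_comp iA pA) _; apply: kw.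
  by apply: Rad_compr sA; apply: Rad_compl hR _; apply: is_hom_comp.
apply/lfunP=> v; rewrite zero_lfunE.
apply: (indecomposable_summands_ind (v := v) (p := fun z => f z = 0)).
- exact: linear0.
- by move=> u u' gu gu'; rewrite linearD /= gu gu' addr0.
move=> Z' r i Zind rA iA ri; have [j [p [jA pA pj]]] := MP _ Zind.
have -> : i (r v) = (i \o p)%VF (j (r v)).
  by have /lfunP/(_ (r v)) := pj; rewrite !comp_lfunE lfunE /= => ->.
by apply: via fch (is_hom_comp iA pA) _; apply: killed_leq (leqnSn n) (nM _).
Qed.

End RepresentationFinite.

(** * The torsion class of modules generated by an idempotent *)

Section Generated.
Variables (k : fieldType) (A : falgType k) (e : A).
Implicit Types (M N X Y Z : lmodule A).

(** The trace A e M of the projective module A e in M. *)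
Inductive trace_of M : M -> Prop :=
| trace_of0 : trace_of 0
| trace_ofD u v : trace_of u -> trace_of v -> trace_of (u + v)
| trace_of_gen x m : trace_of (act x (act e m)).

Definition generated_by M := forall m : M, trace_of m.

Lemma trace_of_act M x (m : M) : trace_of m -> trace_of (act x m).
Proof.
elim=> [|u v _ xu _ xv|y n]; first by rewrite linear0; apply: trace_of0.
  by rewrite linearD; apply: trace_ofD.
by rewrite -actM; apply: trace_of_gen.
Qed.

Lemma trace_ofZ M c (m : M) : trace_of m -> trace_of (c *: m).
Proof. by rewrite -[m in c *: m]act1 -actZl; apply: trace_of_act. Qed.

Lemma trace_of_hom M N (f : 'Hom(M, N)) m :
  is_hom f -> trace_of m -> trace_of (f m).
Proof.
move=> fA; elim=> [|u v _ fu _ fv|y n]; first by rewrite linear0; apply: trace_of0.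
  by rewrite linearD; apply: trace_ofD.
by rewrite !fA; apply: trace_of_gen.
Qed.

Lemma generated_quotient M N (f : 'Hom(M, N)) : is_hom f ->
  (forall n, exists m, n = f m) -> generated_by M -> generated_by N.
Proof. by move=> fA fS MG n; have [m ->] := fS n; apply: trace_of_hom. Qed.

Lemma trace_mod M : e * e = e -> exists N (i : 'Hom(N, M)),
  [/\ is_hom i, injective i, forall m, m \in limg i <-> trace_of m & generated_by N].
Proof.
move=> ee; have [||U UE] := vspace_of_pred (p := @trace_of M).
- exact: trace_of0.
- by move=> c u v tu tv; apply: trace_ofD => //; apply: trace_ofZ.
have [|N [i [iA iI iU _]]] := @submodule_mod _ _ M U.
  by move=> x m /UE tm; apply/UE/trace_of_act.
exists N, i; split=> // [m|n]; first by rewrite iU.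
have : trace_of (i n) by apply/UE; rewrite -iU memv_img ?memvf.
move inE : (i n) => m tm; elim: tm n inE => [|u v tu IHu tv IHv|x u] n inE.
- by have -> : n = 0 by [apply: iI; rewrite inE linear0]; apply: trace_of0.
- have lift w : trace_of w -> exists w', i w' = w.
    by move=> /UE; rewrite -iU => /memv_imgP[w' _ ->]; exists w'.
  have [u' u'E] := lift u tu; have [v' v'E] := lift v tv.
  have -> : n = u' + v' by apply: iI; rewrite inE linearD /= u'E v'E.
  by apply: trace_ofD; [apply: IHu|apply: IHv].
have : act e u \in limg i by rewrite iU; apply/UE; rewrite -[act e u]act1; apply: trace_of_gen.
move=> /memv_imgP[u' _ u'E].
have -> : n = act x (act e u') by apply: iI; rewrite inE !iA -u'E -!actM -mulrA ee.
exact: trace_of_gen.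
Qed.

End Generated.

Lemma principal_actE (k : fieldType) (A : falgType k) (y x : A) (u : principal_mod y) :
  vsval (act x u) = x * vsval u.
Proof. exact: vsprojK (left_ideal_gen_mul x u). Qed.

Lemma principal_generator (k : fieldType) (A : falgType k) (x : A) :
  exists u : principal_mod x, vsval u = x.
Proof.
exists (vsproj (left_ideal_gen x) x); apply: vsprojK.
by apply/left_ideal_genP; exists 1; rewrite mul1r.
Qed.

Section Sink.
Variables (k : fieldType) (A : falgType k) (ea : A).
Hypotheses (ea_neq0 : ea != 0) (eaea : ea * ea = ea).
Hypothesis ea_line : forall x : A, exists c, x * ea = c *: ea.
Implicit Types (M N X Y Z : lmodule A).

Let e : A := 1 - ea.

Lemma compl_idem : [/\ e * e = e, e * ea = 0 & ea * e = 0].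
Proof.
have e1 : e * ea = 0 by rewrite mulrBl mul1r eaea subrr.
have e2 : ea * e = 0 by rewrite mulrBr mulr1 eaea subrr.
by split=> //; rewrite {2}/e mulrBr mulr1 e1 subr0.
Qed.

Lemma idem_split M (m : M) : act e m + act ea m = m.
Proof. by rewrite -actDl subrK act1. Qed.

Lemma act_sink M x (m : M) : act ea m = m -> exists c, act x m = c *: m.
Proof.
by move=> <-; have [c xea] := ea_line x; exists c; rewrite -actM xea actZl.
Qed.

(** The quotient M / A e M is a multiple of the simple projective module A ea. A
    retraction is obtained from any linear projection pr onto A e M by keeping
    e m and applying pr inside ea M only, where A acts by scalars. *)
Lemma trace_summand M : exists N (i : 'Hom(N, M)) (p : 'Hom(M, N)),
  [/\ is_hom i /\ is_hom p, (p \o i)%VF = \1%VF,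
      forall m, trace_of e m -> i (p m) = m & generated_by e N].
Proof.
have [ee eea eae] := compl_idem.
have [N [i [iA iI iU NG]]] := trace_mod M ee.
pose pr := daddv_pi (limg i) (limg i)^C.
have prU m : m \in limg i -> pr m = m by move=> mU; rewrite /pr daddv_pi_id ?capv_compl.
have trE x m : act x (act e m) \in limg i by apply/iU; apply: trace_of_gen.
pose q m : M := act e m + act ea (pr (act ea m)).
have qU m : q m \in limg i.
  apply: memvD; first by rewrite -[act e m]act1 trE.
  by apply/iU/trace_of_act/iU; apply: memv_pi.
have qL : linear q.
  by move=> c u v; rewrite /q !linearP scalerDr addrACA.
have q_id m : m \in limg i -> q m = m.
  move=> mU; rewrite /q prU; last by apply/iU/trace_of_act/iU.
  by rewrite -actM eaea idem_split.
have qA x m : q (act x m) = act x (q m).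
  rewrite -[in LHS](idem_split m).
  have [c xea] := ea_line x.
  have -> : act x (act e m + act ea m) = c *: act ea m + act x (act e m).
    by rewrite linearD /= -[act x (act ea m)]actM xea actZl addrC.
  rewrite qL (q_id _ (trE x m)) /q [RHS]linearD /= -[act e (act ea m)]actM eea.
  by rewrite act0l add0r -!actM eaea xea actZl addrC.
have [q' [q'A q'E]] := hom_exists qL qA.
have [m|p [pA pE]] := hom_lift iA iI q'A; first by rewrite q'E.
exists N, i, p; split=> // [|m /iU mU]; last by rewrite pE q'E q_id.
apply/lfunP=> n; apply: iI; rewrite comp_lfunE pE q'E lfunE /= q_id //.
by rewrite memv_img ?memvf.
Qed.

Lemma principal_line (u : principal_mod ea) : exists c, vsval u = c *: ea.
Proof.
have /left_ideal_genP[y ->] := subvsP u; exact: ea_line.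
Qed.

Lemma principal_indecomposable : indecomposable (principal_mod ea).
Proof.
have [u uE] := principal_generator ea.
have u0 : u != 0 by apply: contra ea_neq0 => /eqP u0; rewrite -uE u0 linear0.
split.
  by apply: contra u0 => /eqP P0; rewrite -memv0 -P0 memvf.
have full (V : {vspace principal_mod ea}) : V <> 0%VS -> u \in V.
  move=> V0; have [v vV v0] : exists2 v, v \in V & v != 0.
    by exists (vpick V); rewrite ?memv_pick // vpick0; apply/eqP.
  have [c vE] := principal_line v.
  have {vE} vE : v = c *: u by apply: subvs_inj; rewrite vE linearZ /= uE.
  have c0 : c != 0 by apply: contra v0 => /eqP c0; rewrite vE c0 scale0r.
  by rewrite -[u](scalerK c0) -vE memvZ.
move=> U W _ _ _ UW0; have [|U0] := classic (U = 0%VS); first by left.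
right; apply: NNPP => W0; case/negP: u0.
by rewrite -memv0 -UW0 memv_cap !full.
Qed.

(** A functional on Z vanishing on A e Z is A-linear as a map from Z to the
    simple projective module A ea. So if h u were outside A e Z, the identity
    of A ea would factor through h. *)
Lemma Rad_sink_trace X Z (h : 'Hom(X, Z)) (u : X) :
  Rad h -> act ea u = u -> trace_of e (h u).
Proof.
move=> [hA hrad] eau; have [ee eea eae] := compl_idem.
have [N [i [iA iI iU _]]] := trace_mod Z ee.
apply/iU/negPn/negP=> /functional_off[t [tu t0]].
pose P := principal_mod ea.
have [f [fA fE]] : exists f : 'Hom(P, X), is_hom f /\ forall y, f y = act (vsval y) u.
  apply: hom_exists => [c y z|x y]; first by rewrite linearP act_linearl.
  by rewrite principal_actE actM.
have [w wE] := principal_generator ea.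
have te m : t (act e m) = 0.
  by apply/t0/iU; rewrite -[act e m]act1; apply: trace_of_gen.
have [g [gA gE]] : exists g : 'Hom(Z, P), is_hom g /\ forall z, g z = (t z : k) *: w.
  apply: hom_exists => [c y z|x z]; first by rewrite linearP scalerDl scalerA.
  apply: subvs_inj; rewrite principal_actE !linearZ /= wE.
  have [c xea] := ea_line x; rewrite -scalerAr xea scalerA; congr (_ *: _).
  rewrite -{1}(idem_split z) linearD /= -!actM xea actZl linearD linearZ /=.
  have -> : t (act (x * e) z) = 0.
    by rewrite actM; apply/t0/iU; apply: trace_of_gen.
  rewrite add0r -[z in RHS](idem_split z) linearD /= te add0r.
  exact: mulrC.
case: (hrad P f g principal_indecomposable fA gA).
have -> : (g \o (h \o f) = \1)%VF.
  apply/lfunP=> y; rewrite !comp_lfunE lfunE /= gE fE hA.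
  have [c yE] := principal_line y; apply: subvs_inj.
  rewrite linearZ /= wE yE actZl linearZ /= -hA eau tu; congr (_ *: _).
  exact: mulr1.
by apply: (iso_of_inverse (g := \1%VF)) (@is_hom_id _ _ P) _ _; rewrite comp_lfun1l.
Qed.

(** Homomorphisms preserve traces, and traces are direct summands, so a radical
    map between modules stays radical between their traces. *)
Lemma rad_chain_trace n Z Y (g : 'Hom(Z, Y)) N (i : 'Hom(N, Z)) :
    rad_chain (@any_module _ A) n g -> generated_by e N -> is_hom i ->
  exists N' (i' : 'Hom(N', Y)) (g' : 'Hom(N, N')),
    [/\ rad_chain (generated_by e) n g', is_hom i' & (i' \o g' = g \o i)%VF].
Proof.
move=> gch NG iA; elim: n Y g gch => [|n IHn] Y g.
  move=> [_ _ gA]; have [N' [i' [p [[i'A pA] pi ip N'G]]]] := trace_summand Y.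
  exists N', i', (p \o (g \o i))%VF; split=> //.
    by split=> //; do 2?apply: is_hom_comp.
  apply/lfunP=> v; rewrite !comp_lfunE ip //.
  by do 2?apply: trace_of_hom.
move=> [Z' [g0 [h [/IHn[N0 [i0 [g' [g'ch i0A ig]]]] _ hR ->]]]].
have [_ N0G g'A] := rad_chain_hom g'ch.
have [N' [i' [p [[i'A pA] pi ip N'G]]]] := trace_summand Y.
exists N', i', ((p \o (h \o i0)) \o g')%VF; split=> //.
  by exists N0, g', (p \o (h \o i0))%VF; split=> //; apply: Rad_comp.
rewrite -[RHS]comp_lfunA -ig; apply/lfunP=> v; rewrite !comp_lfunE ip //.
by do 2?apply: trace_of_hom => //; exact: Rad_hom.
Qed.

(** An endomorphism of X that factors through f is not injective. *)
Lemma Rad_noninjective X Y (f : 'Hom(X, Y)) v : indecomposable X -> is_hom f ->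
  v != 0 -> f v = 0 -> Rad f.
Proof.
move=> Xind fA v0 fv; apply: nilpotent_Rad => // g gA.
have [gf|//] := indecomposable_end Xind (is_hom_comp gA fA).
have [_ /bij_inj gfI] := gf; case/eqP: v0; apply: gfI.
by rewrite comp_lfunE fv !linear0.
Qed.

(** A chain that does not vanish on A e X restricts to the traces. If it is
    nonzero only on a copy of S = A ea in X, its first map sends S into the
    trace of the next module Z. This map is traded for a new last one: the rest
    of the chain sends S to a line in an indecomposable quotient Y' of the trace
    of Y, and dividing Y' by this line is a radical map. The composite is not
    zero, as the trace of Z has no quotient S. *)
Lemma rad_chain_generated n X Y (f : 'Hom(X, Y)) :
    rad_chain (@any_module _ A) n.+1 f -> f <> 0 ->
  exists X' Y' (f' : 'Hom(X', Y')), rad_chain (generated_by e) n.+1 f' /\ f' <> 0.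
Proof.
move=> fch f0; have [ee eea eae] := compl_idem.
have [[v [tv fv]]|fno] := classic (exists v, trace_of e v /\ f v != 0).
  have [N [i [iA iI iU NG]]] := trace_mod X ee.
  have [N' [i' [g' [g'ch i'A ig]]]] := rad_chain_trace fch NG iA.
  exists N, N', g'; split=> // g'0; case/negP: fv.
  move/iU/memv_imgP: tv => [u _ ->]; have /lfunP/(_ u) := ig.
  by rewrite !comp_lfunE => <-; rewrite g'0 zero_lfunE linear0.
have [Z [h [g [_ hR gch fE]]]] := rad_chain_front fch.
have [x [eax fx]] : exists x, act ea x = x /\ f x != 0.
  apply: NNPP => no; apply: f0; apply/lfunP=> v; rewrite zero_lfunE.
  rewrite -(idem_split v) linearD /=; apply/eqP/negPn/negP=> fv.
  case: no; exists (act ea v); split; first by rewrite -actM eaea.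
  apply: contra fv => /eqP->; rewrite addr0; apply/negPn/negP=> fv.
  by apply: fno; exists (act e v); split=> //; rewrite -[act e v]act1; apply: trace_of_gen.
have [N [i [iA iI iU NG]]] := trace_mod Z ee.
have [N' [i' [g' [g'ch i'A ig]]]] := rad_chain_trace gch NG iA.
have /iU/memv_imgP[z _ zE] := Rad_sink_trace hR eax.
have eaz : act ea z = z by apply: iI; rewrite iA -zE -(Rad_hom hR) eax.
have gz0 : g' z <> 0.
  move=> gz0; case/negP: fx; rewrite fE comp_lfunE zE.
  by have /lfunP/(_ z) := ig; rewrite !comp_lfunE gz0 linear0 => <-.
have [_ N'G g'A] := rad_chain_hom g'ch.
have [Y' [r [s [Y'ind rA sA rs ry0]]]] : exists Y' (r : 'Hom(N', Y')) (s : 'Hom(Y', N')),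
    [/\ indecomposable Y', is_hom r, is_hom s, (r \o s)%VF = \1%VF & r (g' z) != 0].
  apply: NNPP => no; apply: gz0.
  apply: (indecomposable_summands_ind (v := g' z) (p := fun v => v = 0)) => //.
    by move=> u w -> ->; rewrite addr0.
  move=> Z' r s Z'ind rA sA rs; apply/eqP/negPn/negP=> sr; apply: no.
  exists Z', r, s; split=> //.
  by apply: contra sr => /eqP->; rewrite linear0.
have Y'G : generated_by e Y'.
  apply: generated_quotient rA _ N'G => y; exists (s y).
  by have /lfunP/(_ y) := rs; rewrite comp_lfunE lfunE.
have eay : act ea (r (g' z)) = r (g' z) by rewrite -rA -g'A eaz.
have [|Q [p [pA pS p0]]] := @quotient_mod _ _ Y' <[r (g' z)]>%VS.
  move=> a m /vlineP[c ->]; have [d ay] := act_sink a eay.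
  by rewrite linearZ /= ay !memvZ ?memv_line.
have QG : generated_by e Q := generated_quotient pA pS Y'G.
have pR : Rad p.
  by apply: (Rad_noninjective Y'ind pA ry0); apply/p0; apply: memv_line.
exists N, Q, (p \o (r \o g'))%VF; split.
  exists Y', (r \o g')%VF, p; split=> //; exact: rad_chain_compl.
move=> prg0; case/eqP: ry0.
have rgA : is_hom (r \o g')%VF := is_hom_comp rA g'A.
have: trace_of e z by apply: NG.
rewrite -comp_lfunE; elim=> [|u v _ ru _ rv|a m]; first exact: linear0.
  by rewrite linearD /= ru rv addr0.
have : (r \o g')%VF m \in <[r (g' z)]>%VS.
  by apply/p0; rewrite -comp_lfunE prg0 zero_lfunE.
move=> /vlineP[c rgm].
by rewrite !rgA rgm -eay !linearZ /= -[act e _]actM eea act0l !linear0.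
Qed.

End Sink.

(** * The functor D Hom_A(T, -) to modules over End_A(T) *)

Section DualHom.
Variables (k : fieldType) (A : falgType k) (T : lmodule A).
Variables (B : falgType k) (phi : {linear B -> 'End(T)}).
Hypothesis phi_End : is_End_algebra phi.
Implicit Types X Y Z : lmodule A.

Let phi1 : phi 1 = \1%VF. Proof. by case: phi_End. Qed.

Let phiM b c : phi (b * c) = (phi b \o phi c)%VF. Proof. by case: phi_End. Qed.

Let phi_hom b : is_hom (phi b).
Proof. by case: phi_End => _ _ _ /(_ (phi b)) [_]; apply; exists b. Qed.

Notation HomT X := (subvs_of (hom_space T X)).

Definition hom_in X (u : 'Hom(T, X)) : HomT X := vsproj (hom_space T X) u.

Lemma hom_inK X (u : 'Hom(T, X)) : is_hom u -> vsval (hom_in u) = u.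
Proof. by move=> uA; apply: vsprojK; apply/hom_spaceP. Qed.

Definition precomp X (b : B) : 'End(HomT X) :=
  linfun (fun u : HomT X => hom_in (vsval u \o phi b)%VF).

Definition postcomp X Y (h : 'Hom(X, Y)) : 'Hom(HomT X, HomT Y) :=
  linfun (fun u : HomT X => hom_in (h \o vsval u)%VF).

Lemma precompE X b (u : HomT X) : vsval (precomp X b u) = (vsval u \o phi b)%VF.
Proof.
rewrite linfun_apply; first by rewrite hom_inK //; apply: is_hom_comp (hom_in_space u) _.
by move=> c v w; rewrite /hom_in linearP comp_lfunDl -comp_lfunZl linearP.
Qed.

Lemma postcompE X Y (h : 'Hom(X, Y)) u :
  is_hom h -> vsval (postcomp h u) = (h \o vsval u)%VF.
Proof.
move=> hA; rewrite linfun_apply.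
  by rewrite hom_inK //; apply: is_hom_comp hA (hom_in_space u).
by move=> c v w; rewrite /hom_in linearP comp_lfunDr -comp_lfunZr linearP.
Qed.

(** Hom_A(T, X) is a right module over B = End_A(T), so its dual is a left one. *)
Definition dual_hom X : lmodule B.
Proof.
refine (@LModule k B 'Hom(HomT X, k^o) (fun b t => (t \o precomp X b)%VF) _ _ _ _).
- move=> t c x y; apply/lfunP=> u; rewrite add_lfunE scale_lfunE !comp_lfunE -linearP.
  congr (t _); apply: subvs_inj; rewrite linearP /= !precompE linearP.
  by rewrite comp_lfunDr -comp_lfunZr.
- by move=> x c t s; rewrite comp_lfunDl -comp_lfunZl.
- move=> t; apply/lfunP=> u; rewrite comp_lfunE; congr (t _).
  by apply: subvs_inj; rewrite precompE phi1 comp_lfun1r.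
- move=> x y t; apply/lfunP=> u; rewrite !comp_lfunE; congr (t _).
  by apply: subvs_inj; rewrite !precompE phiM comp_lfunA.
Defined.

Definition dual_hom_map X Y (h : 'Hom(X, Y)) : 'Hom(dual_hom Y, dual_hom X) :=
  linfun (fun t : 'Hom(HomT Y, k^o) => (t \o postcomp h)%VF).

Lemma dual_hom_mapE X Y (h : 'Hom(X, Y)) (t : dual_hom Y) :
  dual_hom_map h t = ((t : 'Hom(HomT Y, k^o)) \o postcomp h)%VF.
Proof.
by apply: linfun_apply => c t' s; rewrite comp_lfunDl -comp_lfunZl.
Qed.

Lemma dual_hom_map_hom X Y (h : 'Hom(X, Y)) : is_hom h -> is_hom (dual_hom_map h).
Proof.
move=> hA b t; rewrite !dual_hom_mapE /=; apply/lfunP=> u; rewrite !comp_lfunE.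
by congr (t _); apply: subvs_inj; rewrite !(precompE, postcompE) // comp_lfunA.
Qed.

Lemma dual_hom_map_id X : dual_hom_map (\1 : 'End(X))%VF = \1%VF.
Proof.
apply/lfunP=> t; rewrite dual_hom_mapE lfunE /=; apply/lfunP=> u; rewrite comp_lfunE.
congr (t _); apply: subvs_inj; rewrite postcompE ?comp_lfun1l //; exact: is_hom_id.
Qed.

Lemma dual_hom_map_comp X Y Z (g : 'Hom(Y, Z)) (f : 'Hom(X, Y)) :
  is_hom g -> is_hom f ->
  dual_hom_map (g \o f) = (dual_hom_map f \o dual_hom_map g)%VF.
Proof.
move=> gA fA; apply/lfunP=> t; rewrite comp_lfunE !dual_hom_mapE; apply/lfunP=> u.
rewrite !comp_lfunE; congr (t _); apply: subvs_inj.
by rewrite !postcompE ?comp_lfunA //; apply: is_hom_comp.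
Qed.

Lemma dual_hom_map_eq0 X Y (h : 'Hom(X, Y)) : is_hom h ->
  dual_hom_map h = 0 <-> forall u : 'Hom(T, X), is_hom u -> (h \o u)%VF = 0.
Proof.
move=> hA; split=> [h0 u uA|h0].
  rewrite -(hom_inK uA) -postcompE //.
  suff -> : postcomp h (hom_in u) = 0 by rewrite linear0.
  apply: dual_separates => t.
  have /lfunP/(_ t) := h0; rewrite dual_hom_mapE zero_lfunE => /lfunP/(_ (hom_in u)).
  by rewrite comp_lfunE zero_lfunE.
apply/lfunP=> t; rewrite dual_hom_mapE zero_lfunE; apply/lfunP=> u.
rewrite comp_lfunE zero_lfunE.
have -> : postcomp h u = 0; last exact: linear0.
apply: subvs_inj; rewrite postcompE // h0 ?linear0 //; exact: hom_in_space.
Qed.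

Lemma dual_hom_map_lpow X (f : 'End(X)) n : is_hom f ->
  dual_hom_map (lpow f n) = lpow (dual_hom_map f) n.
Proof.
move=> fA; elim: n => [|n IHn]; first exact: dual_hom_map_id.
rewrite [in LHS]/lpow /= -/(lpow f n) dual_hom_map_comp ?IHn //; last exact: is_hom_lpow.
by apply/lfunP=> t; rewrite lpowSr comp_lfunE.
Qed.

(** A map of duals is a transpose, and separation by functionals shows that the
    transposed map is linear over B. *)
Lemma dual_hom_map_full X Y (F : 'Hom(dual_hom Y, dual_hom X)) : is_hom F ->
  exists psi : 'Hom(HomT X, HomT Y),
    (forall t, F t = ((t : 'Hom(HomT Y, k^o)) \o psi)%VF) /\
    forall b u, psi (precomp X b u) = precomp Y b (psi u).
Proof.
move=> FA; have [psi psiE] := dual_full F; exists psi; split=> // b u.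
apply/eqP; rewrite -subr_eq0; apply/eqP/dual_separates => t.
have := FA b t; rewrite !psiE /= => /lfunP/(_ u).
by rewrite !comp_lfunE linearB /= => ->; rewrite subrr.
Qed.

Section FullyFaithful.
Variable C : lmodule A -> Prop.
Hypothesis faithfulT : forall X Y (h : 'Hom(X, Y)), C X -> is_hom h ->
  (forall u : 'Hom(T, X), is_hom u -> (h \o u)%VF = 0) -> h = 0.
Hypothesis fullT : forall X Y (psi : 'Hom(HomT X, HomT Y)), C X -> C Y ->
  (forall b u, psi (precomp X b u) = precomp Y b (psi u)) ->
  exists h : 'Hom(X, Y), is_hom h /\ forall u, psi u = postcomp h u.

(** A map f is radical when its composites with all maps back are nilpotent,
    a condition that fully faithful functors preserve. *)
Lemma dual_hom_map_Rad X Y (f : 'Hom(X, Y)) : C X -> C Y -> Rad f ->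
  Rad (dual_hom_map f).
Proof.
move=> CX CY fR; have fA := Rad_hom fR.
apply: nilpotent_Rad (dual_hom_map_hom fA) _ => G GA.
have [psi [Gpsi psiB]] := dual_hom_map_full GA.
have [g [gA psig]] := fullT CY CX psiB.
have -> : G = dual_hom_map g.
  apply/lfunP=> t; rewrite Gpsi dual_hom_mapE; apply/lfunP=> u.
  by rewrite !comp_lfunE psig.
have [n fg0] := Rad_nilpotent (Rad_compr fR gA); exists n.
rewrite -dual_hom_map_comp // -dual_hom_map_lpow; last exact: is_hom_comp.
rewrite fg0; apply/dual_hom_map_eq0; first exact: is_hom0.
by move=> u _; rewrite comp_lfun0l.
Qed.

Lemma dual_hom_map_chain n X Y (f : 'Hom(X, Y)) : rad_chain C n f ->
  rad_chain (@any_module _ B) n (dual_hom_map f).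
Proof.
elim: n Y f => [|n IHn] Y f.
  by case=> _ _ fA; split=> //; apply: dual_hom_map_hom.
move=> [Z [g [h [gch CY hR ->]]]]; have [CX CZ gA] := rad_chain_hom gch.
rewrite dual_hom_map_comp //; last exact: Rad_hom hR.
by apply: rad_chain_back => //; [exact: dual_hom_map_Rad|exact: IHn].
Qed.

Lemma rad_chain_eq0 n X Y (f : 'Hom(X, Y)) :
  Rad_pow_zero B n.+1 -> rad_chain C n.+1 f -> f = 0.
Proof.
move=> /Rad_pow_zero_chains Bn fch; have [CX _ fA] := rad_chain_hom fch.
by apply: faithfulT => //; apply/dual_hom_map_eq0/Bn/dual_hom_map_chain.
Qed.

End FullyFaithful.
End DualHom.

(** * A presentation of the inverse translate *)

Section Projectives.
Variables (k : fieldType) (R : falgType k).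

Lemma hom_descend (M N X : lmodule R) (q : 'Hom(M, N)) (f : 'Hom(M, X)) :
    is_hom q -> is_hom f -> limg q = fullv -> (lker q <= lker f)%VS ->
  exists g : 'Hom(N, X), is_hom g /\ forall m, g (q m) = f m.
Proof.
move=> qA fA qS qf; exists (f \o q^-1)%VF.
have gq m : (f \o q^-1)%VF (q m) = f m.
  rewrite comp_lfunE; apply/eqP; rewrite -subr_eq0 -linearB -memv_ker.
  apply: (subvP qf); rewrite memv_ker linearB /= limg_lfunVK ?subrr //.
  by rewrite memv_img ?memvf.
split=> // x n; have : n \in limg q by rewrite qS memvf.
by move=> /memv_imgP[m _ ->]; rewrite -qA !gq fA.
Qed.

(** The free module R^s maps onto P, and a section of this map has the
    functionals ps i as its components. *)
Lemma dual_basis (P : lmodule R) s (p : 'I_s -> P) : projective_mod P ->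
    (forall m, exists c : 'I_s -> R, m = \sum_i act (c i) (p i)) ->
  exists ps : 'I_s -> 'Hom(P, regular_mod R),
    (forall i, is_hom (ps i)) /\ forall m, m = \sum_i act (ps i m : R) (p i).
Proof.
move=> Pproj pgen; pose V : vectType k := {ffun 'I_s -> R}.
pose a (x : R) (v : V) : V := [ffun i => x * v i].
have aL v : linear (a^~ v).
  by move=> c x y; apply/ffunP=> i; rewrite !ffunE mulrDl scalerAl.
have aR x : linear (a x).
  by move=> c u v; apply/ffunP=> i; rewrite !ffunE mulrDr scalerAr.
have a1 v : a 1 v = v by apply/ffunP=> i; rewrite ffunE mul1r.
have aM x y v : a (x * y) v = a x (a y v).
  by apply/ffunP=> i; rewrite !ffunE mulrA.
pose F := @LModule k R V a aL aR a1 aM.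
have [||g [gA gE]] := @hom_exists _ _ F P (fun v : V => \sum_i act (v i) (p i)).
- move=> c u v; rewrite scaler_sumr -big_split; apply: eq_bigr => i _.
  by rewrite !ffunE act_linearl.
- move=> x v; rewrite linear_sum; apply: eq_bigr => i _.
  by rewrite !ffunE actM.
have gS : limg g = fullv.
  apply/limg_fullP => m; have [c ->] := pgen m; exists [ffun i => c i].
  by rewrite gE; apply: eq_bigr => i _; rewrite ffunE.
have [h [hA gh]] := Pproj F P g \1%VF gA (@is_hom_id _ _ P) gS.
have coordE i : exists ps : 'Hom(P, regular_mod R), is_hom ps /\
    forall m, ps m = (h m : V) i.
  apply: hom_exists => [c u v|x m]; first by rewrite linearP !ffunE.
  by rewrite hA ffunE.
have [ps psE] := fin_all_exists coordE.
exists ps; split=> [i|m]; first by case: (psE i).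
have /lfunP/(_ m) := gh; rewrite comp_lfunE lfunE /= gE => {1}<-.
by apply: eq_bigr => i _; case: (psE i) => _ ->.
Qed.

End Projectives.

Section InverseTranslate.
Variables (k : fieldType) (A : falgType k) (ea : A).
Hypotheses (ea_neq0 : ea != 0) (eaea : ea * ea = ea).
Hypothesis ea_line : forall x : A, exists c, x * ea = c *: ea.
Implicit Types (M N X Y Z : lmodule A).
Let e : A := 1 - ea.
Let Aop : falgType k := opp_alg A.
Let regop : lmodule Aop := regular_mod Aop.

(** The model is the cokernel W of a map from A ea to a projective module P,
    where P is the summand of a free module cut out by the idempotent matrix
    sp_idem, the map sends ea to the element of P with components sp_al, and the
    sp_w are the classes in W of the generators of P. Maps from W to X are then
    the solutions of sum_i al_i y_i = 0 in X that are fixed by the matrix. The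
    coordinates sp_coord express that the al_i generate the right ideal ea A e;
    through them, every linear relation with coefficients in ea A e between
    elements of X gives such a solution. *)
Record sink_presentation (W : lmodule A) := SinkPresentation {
  sp_rank : nat;
  sp_al : 'I_sp_rank -> A;
  sp_w : 'I_sp_rank -> W;
  sp_idem : 'I_sp_rank -> 'I_sp_rank -> A;
  sp_coord : 'I_sp_rank -> A -> A;
  sp_rel : \sum_i act (sp_al i) (sp_w i) = 0;
  sp_al_e : forall i, sp_al i * e = sp_al i;
  sp_alP : forall x, ea * x * e = \sum_i sp_al i * sp_coord i x;
  sp_idemP : forall i x, sp_coord i x = \sum_l sp_idem i l * sp_coord l x;
  sp_univ : forall X (y : 'I_sp_rank -> X),
    \sum_i act (sp_al i) (y i) = 0 ->
    (forall i, y i = \sum_l act (sp_idem i l) (y l)) ->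
    exists om : 'Hom(W, X), is_hom om /\ forall i, om (sp_w i) = y i }.

Variable S : lmodule A.
Hypothesis S_sink : isomorphic (principal_mod ea) S.

Let D : lmodule Aop := dual_mod S.

Lemma simple_line : exists s0 : S,
  [/\ s0 != 0, forall v : S, exists c, v = c *: s0
    & forall x c, x * ea = c *: ea -> act x s0 = c *: s0].
Proof.
have [f [fA fb]] := S_sink; have fI := bij_inj fb.
have [w wE] := principal_generator ea.
have w0 : w != 0 by apply: contra ea_neq0 => /eqP w0; rewrite -wE w0 linear0.
exists (f w); split.
- by apply: contra w0 => /eqP fw; apply/eqP/fI; rewrite fw linear0.
- move=> v; have [f' _ fK] := fb; have [c vE] := principal_line ea_line (f' v).
  exists c; rewrite -[v]fK -linearZ; congr (f _).
  by apply: subvs_inj; rewrite vE linearZ /= wE.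
move=> x c xea; rewrite -fA -linearZ; congr (f _).
by apply: subvs_inj; rewrite principal_actE wE linearZ /= wE.
Qed.

Lemma dual_act (x : A) c (t : D) : x * ea = c *: ea -> act (x : Aop) t = c *: t.
Proof.
move=> xea; have [s0 [_ sl sA]] := simple_line; apply/lfunP=> v.
rewrite /= scale_lfunE comp_lfunE lfunE /=.
have [d ->] := sl v; rewrite linearZ /= (sA x c xea) !linearZ /=.
by rewrite !scalerA mulrC.
Qed.

Lemma dual_line (t0 t : D) : t0 != 0 -> exists c, t = c *: t0.
Proof.
have [s0 [_ sl sA]] := simple_line => t00.
have t0s : (t0 : 'Hom(S, k^o)) s0 != 0.
  apply: contra t00 => /eqP ts; apply/eqP/lfunP => v; have [c ->] := sl v.
  by rewrite linearZ /= ts scaler0 zero_lfunE.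
exists ((t : 'Hom(S, k^o)) s0 / (t0 : 'Hom(S, k^o)) s0); apply/lfunP=> v.
have [c ->] := sl v; rewrite scale_lfunE !linearZ /=; congr (_ *: _).
by apply/esym; exact: divfK.
Qed.

Lemma dual_nonzero : exists t : D, t != 0.
Proof.
have [s0 [s00 _ _]] := simple_line; apply: NNPP => no.
case/eqP: s00; apply: dual_separates => t; apply/eqP/negPn/negP=> ts.
by apply: no; exists t; apply: contra ts => /eqP->; rewrite zero_lfunE.
Qed.

(** As D is one dimensional, any p0 outside the kernel of g generates P0. A
    section eps of the resulting map from the regular module identifies P0 with
    the right ideal ea A. *)
Lemma cover_generator (P0 : lmodule Aop) (g : 'Hom(P0, D)) :
    projective_mod P0 -> is_hom g -> limg g = fullv -> superfluous (lker g) ->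
  exists (p0 : P0) (eps : 'Hom(P0, regop)),
    [/\ is_hom eps, eps p0 = ea, forall m, m = act (eps m : Aop) p0 & g p0 != 0].
Proof.
move=> Pproj gA gS gsup.
have [t t0] := dual_nonzero; have [p pt] := (iffLR (limg_fullP g) gS) t.
have eaea1 : ea * ea = 1 *: ea by rewrite scale1r.
pose p0 := act (ea : Aop) p.
have gp0 : g p0 != 0 by rewrite gA (dual_act _ eaea1) scale1r -pt.
have eap0 : act (ea : Aop) p0 = p0 by rewrite -actM opp_algM eaea.
have [||r [rA rE]] := @hom_exists _ _ regop P0 (fun x => act x p0).
- by move=> c x y; rewrite act_linearl.
- by move=> x y; rewrite actM.
have rS : limg r = fullv.
  apply: gsup; first exact: submodule_img.
  apply/vspaceP=> m; rewrite memvf; have [c gm] := dual_line (g m) gp0.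
  rewrite -(subrK (c *: p0) m) addrC memv_add //.
    have -> : c *: p0 = r (c *: 1) by rewrite rE actZl act1.
    by rewrite memv_img ?memvf.
  by rewrite memv_ker linearB linearZ /= gm subrr.
have [|ps [psA psE]] := dual_basis (p := fun _ : 'I_1 => p0) Pproj.
  move=> m; have [x ->] := iffLR (limg_fullP r) rS m.
  by exists (fun=> x); rewrite big_ord1 rE.
pose ep := ps ord0; have {psE} epE m : m = act (ep m : Aop) p0.
  by rewrite {1}[m]psE big_ord1.
have [||eps [epsA epsE]] := @hom_exists _ _ P0 regop (fun m => (ep m : Aop) * (ea : Aop)).
- by move=> c u v; rewrite linearP mulrDl scalerAl.
- by move=> x m; rewrite (psA ord0) /= mulrA.
have epsP m : m = act (eps m : Aop) p0 by rewrite epsE actM eap0 -epE.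
exists p0, eps; split=> //.
have [c cE] : exists c, eps p0 = c *: ea.
  have := epsA ea p0; rewrite eap0 /= => ->.
  exact: ea_line.
(* p0 = eps p0 . p0 = c p0, as the scalar c comes from ea A ea = k ea. *)
suff c1 : c = 1 by rewrite cE c1 scale1r.
have p00 : p0 != 0 by apply: contra gp0 => /eqP->; rewrite linear0.
apply/eqP; rewrite -subr_eq0; apply/negPn/negP=> c1; case/eqP: p00.
apply: (scalerI c1); rewrite scaler0 scalerBl scale1r.
by rewrite {2}[p0]epsP cE actZl eap0 subrr.
Qed.

(** The image of f is the radical of P0 = ea A, which is ea A e as ea A ea = k ea.
    So f kills P1 ea, and as its kernel is superfluous, P1 = P1 e A. *)
Lemma cover_generated (P1 P0 : lmodule Aop) (f : 'Hom(P1, P0)) (g : 'Hom(P0, D)) :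
    projective_mod P0 -> is_hom f -> is_hom g -> limg g = fullv ->
    limg f = lker g -> superfluous (lker g) -> superfluous (lker f) ->
  generated_by (e : Aop) P1.
Proof.
move=> P0proj fA gA gS fg gsup fsup.
have [p0 [eps [epsA eps0 epsP gp0]]] := cover_generator P0proj gA gS gsup.
have [||U UE] := vspace_of_pred (p := @trace_of _ Aop e P1).
- exact: trace_of0.
- by move=> c u v tu tv; apply: trace_ofD => //; apply: trace_ofZ.
suff Ufull : U = fullv by move=> m; apply/UE; rewrite Ufull memvf.
apply: fsup; first by move=> x m /UE tm; apply/UE/trace_of_act.
apply/vspaceP=> m; rewrite memvf.
have -> : m = act (e : Aop) m + act (ea : Aop) m.
  by rewrite -(actDl (A := Aop)) subrK act1.
apply: memv_add.
  by apply/UE; rewrite -[act _ m]act1; apply: trace_of_gen.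
rewrite memv_ker fA; have : f m \in lker g by rewrite -fg memv_img ?memvf.
rewrite memv_ker [f m]epsP gA; have [c xea] := ea_line (eps (f m)).
rewrite (dual_act _ xea) scaler_eq0 (negPf gp0) orbF => /eqP c0.
by rewrite -actM opp_algM xea c0 scale0r act0l.
Qed.

(** W is the cokernel of the transpose of f : P1 -> P0. The dual basis ps of P1
    provides generators of P1^t; the al_i are the images in P0 = ea A of the
    corresponding generators of P1, and generate ea A e, the radical of ea A. *)
Lemma inverse_translate_presentation (W : lmodule A) : is_Tr (dual_mod S) W ->
  inhabited (sink_presentation W) /\ generated_by e W.
Proof.
move=> [P1 [P0 [f [g [q [pres qA qS qf]]]]]].
case: pres => [[P1proj P0proj] [fA gA] [gS fg] [gsup fsup]].
have [ee eea eae] := compl_idem eaea.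
have [p0 [eps [epsA eps0 epsP gp0]]] := cover_generator P0proj gA gS gsup.
have P1gen := cover_generated P0proj fA gA gS fg gsup fsup.
pose s := \dim {:P1}; pose v (i : 'I_s) : P1 := (vbasis {:P1})`_i.
pose p i := act (e : Aop) (v i).
have [|ps [psA psE]] := dual_basis (p := p) P1proj.
  move=> m; elim: (P1gen m) => [|u u' _ [c ->] _ [c' ->]|x u].
  - by exists (fun=> 0); rewrite big1 // => i _; rewrite act0l.
  - exists (fun i => c i + c' i); rewrite -big_split; apply: eq_bigr => i _.
    by rewrite actDl.
  exists (fun i => coord (vbasis {:P1}) i u *: x).
  rewrite [u in LHS](coord_vbasis (memvf u)) !linear_sum; apply: eq_bigr => i _.
  by rewrite !linearZ actZl.
have psE' (h : transpose_mod P1) m :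
    vsval h m = \sum_i (vsval h (p i) : A) * (ps i m : A).
  rewrite {1}[m]psE linear_sum; apply: eq_bigr => i _ /=.
  by rewrite (hom_in_space h).
have transA (P : lmodule Aop) (x : A) (h : transpose_mod P) m :
    vsval (act x h) m = x * (vsval h m : A).
  by rewrite /= vsprojK ?transpose_closed // comp_lfunE lfunE.
pose H i : transpose_mod P1 := vsproj (hom_space P1 regop) (ps i).
have HE i : vsval (H i) = ps i by apply: vsprojK; apply/hom_spaceP.
have H_gen (h : transpose_mod P1) : h = \sum_i act (vsval h (p i) : A) (H i).
  apply: subvs_inj; apply/lfunP=> m; rewrite psE' linear_sum sum_lfunE.
  by apply: eq_bigr => i _; rewrite transA HE.
pose al i : A := eps (f (p i)).
have hp i (h : transpose_mod P1) : (vsval h (p i) : A) = (vsval h (v i) : A) * e.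
  exact: (hom_in_space h).
have gen_t : generated_by e (transpose_mod P1).
  move=> h; rewrite (H_gen h); apply: big_ind => [|u u'|i _]; first exact: trace_of0.
    exact: trace_ofD.
  by rewrite hp actM; apply: trace_of_gen.
split; last by apply: generated_quotient qA _ gen_t; apply/limg_fullP.
pose pre (x : A) : P1 := (f^-1)%VF (act (ea * x * e : Aop) p0).
have preP x : f (pre x) = act (ea * x * e : Aop) p0.
  apply: limg_lfunVK; rewrite fg memv_ker gA (dual_act (c := 0)) ?scale0r //.
  by rewrite -mulrA eea mulr0.
have eps_act x m : eps (act (x : Aop) m) = (eps m : A) * x.
  exact: epsA.
have ps_act i x m : ps i (act (x : Aop) m) = (ps i m : A) * x.
  exact: psA.
have fpsE m : (eps (f m) : A) = \sum_i al i * (ps i m : A).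
  rewrite {1}[m]psE !linear_sum; apply: eq_bigr => i _ /=.
  by rewrite fA eps_act.
pose t : transpose_mod P0 := vsproj (hom_space P0 regop) eps.
have tE : vsval t = eps by apply: vsprojK; apply/hom_spaceP.
constructor; apply: (@SinkPresentation W s al (fun i => q (H i))
  (fun i l => ps i (p l)) (fun i x => ps i (pre x))).
- suff: \sum_i act (al i) (H i) \in lker q.
    rewrite memv_ker linear_sum => /eqP q0; rewrite -[RHS]q0.
    by apply: eq_bigr => i _; rewrite /= -qA.
  have -> : \sum_i act (al i) (H i) = transpose_map f t.
    apply: subvs_inj; apply/lfunP=> m; rewrite transpose_mapE // comp_lfunE tE.
    rewrite linear_sum sum_lfunE fpsE.
    by apply: eq_bigr => i _; rewrite transA HE.
  by rewrite qf memv_img ?memvf.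
- by move=> i; rewrite /al /p fA eps_act -mulrA ee.
- by move=> x; rewrite -fpsE preP eps_act eps0 !mulrA eaea.
- move=> i x; rewrite {1}[pre x]psE linear_sum; apply: eq_bigr => l _ /=.
  by rewrite ps_act.
move=> X y aly yE.
have [||F [FA FE]] := @hom_exists _ _ (transpose_mod P1) X
    (fun h => \sum_i act (vsval h (p i) : A) (y i)).
- move=> c u u'; rewrite scaler_sumr -big_split; apply: eq_bigr => i _.
  by rewrite linearP add_lfunE scale_lfunE act_linearl.
- move=> x h; rewrite linear_sum; apply: eq_bigr => i _.
  by rewrite transA actM.
have [|om [omA omE]] := hom_descend qA FA qS.
  rewrite qf; apply/subvP=> _ /memv_imgP[h _ ->]; rewrite memv_ker FE.
  apply/eqP; transitivity (act (vsval h p0 : A) (\sum_i act (al i) (y i))); last first.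
    by rewrite aly linear0.
  rewrite linear_sum.
  apply: eq_bigr => i _; rewrite transpose_mapE // comp_lfunE /= -actM.
  by rewrite {1}[f (p i)]epsP (hom_in_space h).
exists om; split=> // i; rewrite omE FE yE.
by apply: eq_bigr => l _; rewrite HE.
Qed.

End InverseTranslate.

(** * Full faithfulness on the torsion class *)

Section FullyFaithfulTilting.
Variables (k : fieldType) (A : falgType k) (ea : A) (T W : lmodule A).
Variables (B : falgType k) (phi : {linear B -> 'End(T)}).
Implicit Types X Y : lmodule A.
Let e : A := 1 - ea.

Hypothesis phi_End : is_End_algebra phi.
Hypothesis eaea : ea * ea = ea.

Variables (rho : 'Hom(T, regular_mod A)) (eps : T).
Hypotheses (rhoA : is_hom rho) (rho_eps : rho eps = e).

Variables (iW : 'Hom(W, T)) (pW : 'Hom(T, W)).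
Hypotheses (iWA : is_hom iW) (pWA : is_hom pW) (piW : (pW \o iW)%VF = \1%VF).

Hypothesis T_generated : generated_by e T.

Variable pres : sink_presentation ea W.
Local Notation s := (sp_rank pres).
Local Notation al := (@sp_al _ _ _ _ pres).
Local Notation w := (@sp_w _ _ _ _ pres).
Local Notation G := (@sp_idem _ _ _ _ pres).
Local Notation c := (@sp_coord _ _ _ _ pres).

Let ee : e * e = e. Proof. by case: (compl_idem eaea). Qed.

Lemma elt_map X (x : X) :
  exists u : 'Hom(T, X), is_hom u /\ forall t, u t = act (rho t : A) x.
Proof.
apply: hom_exists => [d t t'|a t]; first by rewrite linearP act_linearl.
by rewrite rhoA actM.
Qed.

Lemma tilting_faithful X Y (h : 'Hom(X, Y)) : generated_by e X -> is_hom h ->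
  (forall u : 'Hom(T, X), is_hom u -> (h \o u)%VF = 0) -> h = 0.
Proof.
move=> XG hA h0; apply/lfunP=> x; rewrite zero_lfunE.
elim: (XG x) => [|v v' _ hv _ hv'|a m]; first exact: linear0.
  by rewrite linearD /= hv hv' addr0.
have [u [uA uE]] := elt_map m; have /lfunP/(_ (act a eps)) := h0 u uA.
by rewrite comp_lfunE zero_lfunE uE rhoA rho_eps /= actM.
Qed.

Section Full.
Variables (X Y : lmodule A).
Variable psi : 'Hom(subvs_of (hom_space T X), subvs_of (hom_space T Y)).
Hypothesis psiB : forall b u, psi (precomp phi X b u) = precomp phi Y b (psi u).
Hypothesis X_generated : generated_by e X.

Definition psi_map (u : 'Hom(T, X)) : 'Hom(T, Y) := vsval (psi (hom_in u)).

Lemma psi_map_hom u : is_hom (psi_map u).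
Proof. exact: hom_in_space. Qed.

Lemma psi_mapP d u u' : psi_map (d *: u + u') = d *: psi_map u + psi_map u'.
Proof. by rewrite /psi_map /hom_in !linearP. Qed.

Lemma psi_map0 : psi_map 0 = 0.
Proof. by rewrite /psi_map /hom_in !linear0. Qed.

Lemma psi_map_comp u (sigma : 'End(T)) : is_hom u -> is_hom sigma ->
  psi_map (u \o sigma)%VF = (psi_map u \o sigma)%VF.
Proof.
have [_ _ _ surj] := phi_End; move=> uA /surj[b <-].
rewrite /psi_map -precompE // -psiB; congr (vsval (psi _)).
by apply: subvs_inj; rewrite precompE // !hom_inK //; apply: is_hom_comp; rewrite // surj; exists b.
Qed.

(** The graph of the map h : X -> Y to be found: as h u has to be psi u, it
    sends u t to (psi u) t, for the elements t of A e T = T. *)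
Inductive graph : X -> Y -> Prop :=
| graph0 : graph 0 0
| graphP d x y x' y' : graph x y -> graph x' y' -> graph (d *: x + x') (d *: y + y')
| graph_gen u a t : is_hom u ->
    graph (u (act a (act e t))) (psi_map u (act a (act e t))).

Lemma graph_total x : exists y, graph x y.
Proof.
elim: (X_generated x) => [|v v' _ [y vy] _ [y' vy']|a m].
- by exists 0; apply: graph0.
- by exists (1 *: y + y'); rewrite -[v]scale1r; apply: graphP.
have [u [uA uE]] := elt_map m; exists (psi_map u (act a (act e eps))).
have -> : act a (act e m) = u (act a (act e eps)).
  by rewrite uE !rhoA rho_eps /= ee actM.
exact: graph_gen.
Qed.

Lemma graph_act b x y : graph x y -> graph (act b x) (act b y).
Proof.
elim=> [|d {}x {}y x' y' _ xy _ xy'|u a t uA]; first by rewrite !linear0; apply: graph0.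
  by rewrite !linearP; apply: graphP.
by rewrite -uA -psi_map_hom -actM; apply: graph_gen.
Qed.

Lemma graph_map u t : is_hom u -> graph (u t) (psi_map u t).
Proof.
move=> uA; elim: (T_generated t) => [|v v' _ hv _ hv'|a m].
- by rewrite !linear0; apply: graph0.
- by rewrite !linearD /= -[u v]scale1r -[psi_map u v]scale1r; apply: graphP.
exact: graph_gen.
Qed.

(** An element x defines a map u : T -> X through the summand A e of T, and e y is
    the value at eps of the image of u under psi. *)
Lemma graph_e x y : graph x y ->
  forall u : 'Hom(T, X), is_hom u -> (forall t, u t = act (rho t : A) x) ->
  act e y = psi_map u eps.
Proof.
elim=> [|d {}x {}y x' y' _ xy _ xy'|v a t vA] u uA uE.
- have -> : u = 0 by apply/lfunP=> t; rewrite uE zero_lfunE linear0.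
  by rewrite psi_map0 zero_lfunE linear0.
- have [u1 [u1A u1E]] := elt_map x; have [u2 [u2A u2E]] := elt_map x'.
  have -> : u = d *: u1 + u2.
    by apply/lfunP=> t; rewrite uE add_lfunE scale_lfunE u1E u2E linearP.
  by rewrite psi_mapP add_lfunE scale_lfunE linearP /= (xy u1) // (xy' u2).
set t0 := act a (act e t) in uE *; have [z [zA zE]] := elt_map t0.
have -> : u = (v \o z)%VF by apply/lfunP=> t1; rewrite comp_lfunE uE zE vA.
by rewrite psi_map_comp // comp_lfunE zE rho_eps -psi_map_hom.
Qed.

(** For x = u (a e t) the element ea a e is sum_i al_i c_i with the coordinates
    c_i of a, which gives the solution yy_i = u (c_i e t). *)
Lemma graph_ea x y : graph x y -> exists (yy : 'I_s -> X) (yy' : 'I_s -> Y),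
  [/\ forall i, graph (yy i) (yy' i),
      act ea x = \sum_i act (al i) (yy i), act ea y = \sum_i act (al i) (yy' i)
    & forall i, yy i = \sum_l act (G i l) (yy l)].
Proof.
elim=> [|d {}x {}y x' y' _ [z [z' [zz zx zy zG]]] _ [v [v' [vv vx vy vG]]]|u a t uA].
- exists (fun=> 0), (fun=> 0); split=> [i||| i]; first exact: graph0.
  + by rewrite linear0 big1 // => i _; rewrite linear0.
  + by rewrite linear0 big1 // => i _; rewrite linear0.
  by rewrite big1 // => l _; rewrite linear0.
- exists (fun i => d *: z i + v i), (fun i => d *: z' i + v' i).
  have sumP (Z : lmodule A) (b : 'I_s -> A) (p q : 'I_s -> Z) : \sum_i act (b i) (d *: p i + q i) =
      d *: (\sum_i act (b i) (p i)) + \sum_i act (b i) (q i).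
    by rewrite scaler_sumr -big_split; apply: eq_bigr => i _; rewrite linearP.
  by split=> [i|||i]; rewrite ?sumP ?linearP /= ?zx ?zy ?vx ?vy -?zG -?vG //; apply: graphP.
pose m i := act (c i a) (act e t).
have ea_m : act ea (act a (act e t)) = \sum_i act (al i) (m i).
  transitivity (act (ea * a * e) (act e t)).
    by rewrite -!actM -(mulrA _ e) ee.
  by rewrite (sp_alP pres) act_suml; apply: eq_bigr => i _; rewrite actM.
have psiA := psi_map_hom u.
exists (fun i => u (m i)), (fun i => psi_map u (m i)); split=> [i||| i].
- exact: graph_gen.
- by rewrite -uA ea_m linear_sum /=; apply: eq_bigr => i _; rewrite uA.
- by rewrite -psiA ea_m linear_sum /=; apply: eq_bigr => i _; rewrite psiA.
rewrite {1}/m (sp_idemP (s := pres)) act_suml linear_sum /=; apply: eq_bigr => l _.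
by rewrite actM uA.
Qed.

(** For e y this is graph_e. The part ea y is governed by the relations
    sum_i al_i x_i = 0 in X; these come from the universal one, which holds in
    the summand W of T, through maps W -> X, and psi is compatible with maps out
    of T. *)
Lemma graph_functional y : graph 0 y -> y = 0.
Proof.
move=> gy; rewrite -(idem_split ea y).
have -> : act e y = 0.
  rewrite (graph_e gy (@is_hom0 _ _ T X)) ?psi_map0 ?zero_lfunE // => t.
  by rewrite zero_lfunE linear0.
rewrite add0r; have [z [z' [zz zx zy zG]]] := graph_ea gy.
have [|om [omA omE]] := sp_univ (s := pres) _ zG; first by rewrite -zx linear0.
have opA : is_hom (om \o pW)%VF by apply: is_hom_comp.
have ez i : act e (z' i) = act e (psi_map (om \o pW)%VF (iW (w i))).
  have [u [uA uE]] := elt_map (z i).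
  rewrite (graph_e (zz i) uA uE); apply/esym.
  apply: (graph_e (graph_map (iW (w i)) opA) uA) => t.
  by rewrite uE comp_lfunE -[pW _]comp_lfunE piW lfunE /= omE.
rewrite zy (eq_bigr (fun i => psi_map (om \o pW)%VF (iW (act (al i) (w i))))).
  by rewrite -!linear_sum (sp_rel pres) !linear0.
move=> i _; rewrite -(sp_al_e (s := pres) i) actM ez -actM sp_al_e.
by rewrite iWA psi_map_hom.
Qed.

Lemma tilting_full :
  exists h : 'Hom(X, Y), is_hom h /\ forall u, psi u = postcomp T h u.
Proof.
have [h hE] := linfun_of_graph graph_total
  (fun d x y x' y' xy x'y' => graphP d xy x'y') graph_functional.
have hA : is_hom h.
  move=> b x; have [y xy] := graph_total x.
  by rewrite (hE _ _ (graph_act b xy)) (hE _ _ xy).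
exists h; split=> // u; apply: subvs_inj; rewrite postcompE //.
have uA := hom_in_space u; apply/lfunP=> t; rewrite comp_lfunE.
by rewrite (hE _ _ (graph_map t uA)) /psi_map /hom_in vsvalK.
Qed.

End Full.
End FullyFaithfulTilting.

(** * The idempotent of a sink *)

Section VertexIdempotents.
Variables (k : fieldType) (Q : quiver) (A : falgType k) (I : kQ k Q -> Prop).
Variable pi : {linear kQ k Q -> A}.
Hypothesis pi_quot : is_quotient_map I pi.

Lemma mem_supp_path (p q : qpath Q) : p \in msupp (kQ_of_path k q) -> p = q.
Proof.
rewrite -mcoeff_neq0 mcoeffU; have [-> //|_] := eqVneq q p.
by move/eqP; case.
Qed.

Lemma sum_vertex_idem : \sum_v vertex_idem pi v = 1.
Proof. by have [<- _ _ _] := pi_quot; rewrite /kQ_one linear_sum. Qed.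

Lemma vertex_idem_ortho v w : v != w -> vertex_idem pi v * vertex_idem pi w = 0.
Proof.
move=> vw; have [_ <- _ _] := pi_quot.
suff -> : kQ_mul (kQ_of_path k (trivial_path v)) (kQ_of_path k (trivial_path w)) = 0.
  exact: linear0.
rewrite /kQ_mul big_seq big1 // => p /mem_supp_path->.
rewrite big_seq big1 // => q /mem_supp_path->.
by rewrite /Defs.pcomp /ptgt /= eq_sym (negPf vw).
Qed.

Lemma vertex_idemK v : vertex_idem pi v * vertex_idem pi v = vertex_idem pi v.
Proof.
rewrite -[RHS]mulr1 -sum_vertex_idem mulr_sumr (bigD1 v) //= big1 ?addr0 // => w wv.
by rewrite vertex_idem_ortho // eq_sym.
Qed.

(** Only the trivial path starts at a sink. *)
Lemma pcomp_sink a (p r : qpath Q) : sink a ->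
  Defs.pcomp p (trivial_path a) = Some r -> r = trivial_path a.
Proof.
move=> asink; rewrite /Defs.pcomp; case: eqP => // /esym pa.
case: insubP => // r' _ rE [<-]; apply: val_inj; rewrite rE /=.
have := valP p; rewrite -/(psrc p) pa /parrows; case: (val p).2 => //= al s.
by rewrite (negPf (asink al)).
Qed.

Lemma sink_line a (x : A) : sink a -> exists c, x * vertex_idem pi a = c *: vertex_idem pi a.
Proof.
move=> asink; have [_ piM piS _] := pi_quot; have [f <-] := piS x.
rewrite -piM; pose line y := exists c, pi y = c *: vertex_idem pi a.
have line0 : line 0 by exists 0; rewrite linear0 scale0r.
have lineD y z : line y -> line z -> line (y + z).
  by move=> [c yc] [d zd]; exists (c + d); rewrite linearD /= yc zd scalerDl.
rewrite -/(line _) /kQ_mul; apply: big_ind => // p _.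
rewrite big_seq; apply: big_ind => // q /mem_supp_path->.
case E: (Defs.pcomp _ _) => [r|//]; rewrite (pcomp_sink asink E).
by exists (mcoeff p f * mcoeff (trivial_path a) (kQ_of_path k (trivial_path a))); rewrite linearZ.
Qed.

End VertexIdempotents.

(** * The summands of the tilting module *)

Section DirectSums.
Variables (k : fieldType) (A : falgType k) (J : finType) (M : J -> lmodule A).
Variable T : lmodule A.
Hypothesis T_sum : is_direct_sum M T.

Lemma direct_sum_retract j : retract (M j) T.
Proof.
have [i [p [homs ip _ _]]] := T_sum; have [iA pA] := homs j.
by exists (i j), (p j).
Qed.

Lemma direct_sum_generated e : (forall j, generated_by e (M j)) -> generated_by e T.
Proof.
have [i [p [homs _ _ sum_ip]]] := T_sum => MG t.
have /lfunP/(_ t) := sum_ip; rewrite lfunE /= => <-; rewrite sum_lfunE.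
apply: big_ind => [|u v|j _]; [exact: trace_of0|exact: trace_ofD|].
by rewrite comp_lfunE; apply: trace_of_hom; [case: (homs j)|apply: MG].
Qed.

Lemma direct_sum_map (X : lmodule A) (f : forall j, 'Hom(M j, X)) (m : forall j, M j) :
    (forall j, is_hom (f j)) ->
  exists (F : 'Hom(T, X)) (t : T), is_hom F /\ F t = \sum_j f j (m j).
Proof.
have [i [p [homs ip ortho _]]] := T_sum => fA.
exists (\sum_j (f j \o p j)%VF), (\sum_j i j (m j)); split.
  apply: big_ind => [|u v|j _]; [exact: is_hom0|exact: is_homD|].
  by apply: is_hom_comp; [apply: fA|case: (homs j)].
rewrite sum_lfunE; apply: eq_bigr => j _; rewrite comp_lfunE; congr (f j _).
rewrite linear_sum (bigD1 j) //= big1 ?addr0 => [|l lj].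
  by have /lfunP/(_ (m j)) := ip j; rewrite comp_lfunE lfunE.
by have /lfunP/(_ (m l)) := ortho l j lj; rewrite comp_lfunE zero_lfunE.
Qed.

End DirectSums.

Section APR.
Variables (k : fieldType) (A : falgType k) (Q : quiver) (I : kQ k Q -> Prop).
Variables (pi : {linear kQ k Q -> A}) (a : vertex Q) (T : lmodule A).
Hypotheses (pi_quot : is_quotient_map I pi) (a_sink : sink a).
Hypothesis T_tilting : is_APR_tilting pi a T.
Let ea := vertex_idem pi a.
Let e : A := 1 - ea.

Lemma compl_vertex_idem b : b != a -> e * vertex_idem pi b = vertex_idem pi b.
Proof.
move=> ba; rewrite mulrBl mul1r (vertex_idem_ortho pi_quot) ?subr0 //.
by rewrite eq_sym.
Qed.

Lemma sum_compl : \sum_(b | b != a) vertex_idem pi b = e.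
Proof.
apply: (addrI ea); rewrite [RHS]addrC subrK -(sum_vertex_idem pi_quot).
by rewrite [RHS](bigD1 a).
Qed.

Lemma vertex_projective_generated b : b != a -> generated_by e (vertex_projective pi b).
Proof.
move=> ba m; have [u uE] := principal_generator (vertex_idem pi b).
have /left_ideal_genP[y yE] := subvsP m.
have -> : m = act y (act e u).
  by apply: subvs_inj; rewrite !principal_actE uE compl_vertex_idem.
exact: trace_of_gen.
Qed.

(** As e is the sum of the idempotents at the vertices b <> a, the P_b add up to
    A e. The map rho is the projection of T to this summand followed by the
    inclusion in A, and eps is the element e of the summand. *)
Lemma APR_structure : exists (W : lmodule A) (rho : 'Hom(T, regular_mod A)) (eps : T)
    (iW : 'Hom(W, T)) (pW : 'Hom(T, W)),
  [/\ ea != 0, is_hom rho /\ rho eps = e, [/\ is_hom iW, is_hom pW & (pW \o iW)%VF = \1%VF],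
      inhabited (sink_presentation ea W) & generated_by e T].
Proof.
have eaea := vertex_idemK pi_quot a.
have ea_line x := sink_line pi_quot x a_sink.
have [S [W [[[S0 _] _] PS _ WS Tsum]]] := T_tilting.
have ea0 : ea != 0.
  apply: contra S0 => /eqP ea0; rewrite -subv0; apply/subvP=> v _.
  have [f [fA [f' _ fK]]] := PS; rewrite -[v]fK memv0.
  have -> : f' v = 0; last by rewrite linear0.
  by apply: subvs_inj; have [c ->] := principal_line ea_line (f' v); rewrite linear0 -/ea ea0 scaler0.
have [Wpres Wgen] := inverse_translate_presentation ea0 eaea ea_line PS WS.
set M := fun b => _ in Tsum.
have Mgen b : generated_by e (M b).
  by rewrite /M; have [_|/vertex_projective_generated] := eqVneq b a.
have [iW [pW [iWA pWA piW]]] : retract W T.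
  by have := direct_sum_retract Tsum a; rewrite /M eqxx.
have incl b : exists f : 'Hom(M b, regular_mod A), is_hom f /\
    exists m, f m = if b == a then 0 else vertex_idem pi b.
  rewrite /M; have [_|ba] := eqVneq b a.
    by exists 0; split; [apply: is_hom0|exists 0; rewrite linear0].
  have [||f [fA fE]] := @hom_exists _ _ (vertex_projective pi b) (regular_mod A) vsval.
  - by move=> c u v; rewrite linearP.
  - by move=> x u; rewrite principal_actE.
  exists f; split=> //; have [u uE] := principal_generator (vertex_idem pi b).
  by exists u; rewrite (fE u); exact: uE.
have [f fP] := fin_all_exists incl.
have [m mE] := fin_all_exists (fun b => proj2 (fP b)).
have [rho [eps [rhoA rhoE]]] := direct_sum_map Tsum m (fun b => proj1 (fP b)).
have Tgen := direct_sum_generated Tsum Mgen.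
exists W, rho, eps, iW, pW; split=> //.
split=> //; rewrite rhoE -sum_compl [RHS]big_mkcond; apply: eq_bigr => b _.
rewrite if_neg.
exact: mE.
Qed.

End APR.

Theorem lemma2p14 (k : closedFieldType) (A : falgType k)
    (Q : quiver) (I : kQ k Q -> Prop) (pi : {linear kQ k Q -> A})
    (hI : admissible I) (hpi : is_quotient_map I pi)
    (a : vertex Q) (ha : sink a)
    (T : lmodule A) (hT : is_APR_tilting pi a T)
    (B : falgType k) (phi : {linear B -> 'End(T)}) (hB : is_End_algebra phi)
    (hfin : representation_finite B) :
  exists rA rB : nat,
    [/\ is_nilpotency_index A rA, is_nilpotency_index B rB & (rA <= rB)%N].
Proof.
have eaea := vertex_idemK hpi a.
have ea_line x := sink_line hpi x ha.
have [W [rho [eps [iW [pW [ea0 [rhoA rho_eps] [iWA pWA piW] [pres] Tgen]]]]]] :=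
  APR_structure hpi ha hT.
have BA n : Rad_pow_zero B n.+1 -> Rad_pow_zero A n.+1.
  move=> Bn; apply/Rad_pow_zero_chains => X Y f fch; apply: NNPP => f0.
  have [X' [Y' [f' [f'ch]]]] := rad_chain_generated ea0 eaea ea_line fch f0.
  case; apply: (rad_chain_eq0 hB _ _ Bn f'ch).
    exact: (tilting_faithful rhoA rho_eps).
  move=> X1 Y1 psi X1G _ psiB.
  exact: (tilting_full hB eaea rhoA rho_eps iWA pWA piW Tgen pres psiB X1G).
have [n Bn] := representation_finite_Rad_pow_zero hfin.
have [rB rBP] := nilpotency_index_exists Bn; have [rB0 BrB _] := rBP.
case: rB rB0 BrB rBP => // r _ Br rBP.
have [rA rAP] := nilpotency_index_exists (BA r Br).
by exists rA, r.+1; split=> //; case: rAP => _ _; apply=> //; apply: BA.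
Qed.
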